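(* There is no rank $6$ non-integral, self-dual modular category associated with $G=\langle(0123)\rangle$; that is, there is no non-integral self-dual modular category $\mathcal{C}$ of rank $6$ whose simple objects can be labelled by $0,\dots,5$ (with $0$ the unit object) so that the image of $\mathrm{Gal}(\mathbb{Q}(S)/\mathbb{Q})$ in $\mathrm{Sym}_6$ equals $\langle(0123)\rangle$.
   Context: A modular category $\mathcal{C}$ is a non-degenerate ribbon fusion category over $\mathbb{C}$. Its rank $r$ is the number of isomorphism classes of simple objects, labelled $0,1,\dots,r-1$, where $0$ is the label of the unit object; $i^*$ denotes the label dual to $i$. $S$ is the unnormalized $r\times r$ $S$-matrix, with $S_{00}=1$, $S_{0j}=d_j$ (the categorical dimensions), $S\bar S=D^2\,\mathrm{Id}$, $D^2=\sum_j d_j^2$, and $\theta_i\theta_jS_{ij}=\sum_k N_{i^*j}^k d_k\theta_k$, where $\theta_i$ are the twists and $N_{ij}^k$ the fusion multiplicities. The eigenvalue matrix is $s=(s_{ij})$, $s_{ij}=S_{ij}/S_{0j}$. The group $\mathrm{Gal}(\mathbb{Q}(S)/\mathbb{Q})$ is abelian and permutes the columns of $s$ faithfully: each $\sigma$ determines a unique permutation of the labels, also denoted $\sigma$, with $\sigma(s_{ij})=s_{i\sigma(j)}$ for all $i,j$. This gives an injection $\mathrm{Gal}(\mathbb{Q}(S)/\mathbb{Q})\to\mathrm{Sym}_r$ (permutations of $\{0,\dots,r-1\}$); $G$ denotes its image, written in cycle notation. $\mathcal{C}$ is self-dual if $i^*=i$ for all $i$. $\mathcal{C}$ is integral if the Frobenius-Perron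 dimension of every simple object is an integer, and non-integral otherwise. *)

(* Defs.v *)
(* The field of complex numbers is R[i] for R : realType. *)
From HB Require Import structures.
From mathcomp Require Import all_boot all_order all_algebra all_fingroup.
From mathcomp Require Import boolp reals.
From mathcomp Require Import complex.

Set Implicit Arguments.
Unset Strict Implicit.
Unset Printing Implicit Defensive.

Import Order.TTheory GRing.Theory Num.Theory.
Local Open Scope ring_scope.

(* The morphism spaces are finite-dimensional: this is part of vectType. *)
Record linearCategory (R : realType) := LinearCategory {
  obj :> Type;
  hom : obj -> obj -> vectType R[i];
  idm : forall X, hom X X;
  mcomp : forall X Y Z, hom Y Z -> hom X Y -> hom X Z;
  mcomp_idl : forall X Y (f : hom X Y), mcomp (idm Y) f = f;
  mcomp_idr : forall X Y (f : hom X Y), mcomp f (idm X) = f;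
  mcompA : forall X Y Z W (h : hom Z W) (g : hom Y Z) (f : hom X Y),
    mcomp h (mcomp g f) = mcomp (mcomp h g) f;
  mcomp_linl : forall X Y Z (f : hom X Y) (a : R[i]) (g g' : hom Y Z),
    mcomp (a *: g + g') f = a *: mcomp g f + mcomp g' f;
  mcomp_linr : forall X Y Z (g : hom Y Z) (a : R[i]) (f f' : hom X Y),
    mcomp g (a *: f + f') = a *: mcomp g f + mcomp g f'
}.

Arguments hom {R l} X Y : rename.
Arguments idm {R l} X : rename.
Arguments mcomp {R l X Y Z} g f : rename.

Declare Scope cat_scope.
Delimit Scope cat_scope with cat.
Local Open Scope cat_scope.

Notation "g '\oc' f" := (mcomp g f)
  (at level 40, left associativity, format "g  '\oc'  f") : cat_scope.

Section AbelianCategories.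
Variables (R : realType) (C : linearCategory R).
Implicit Types X Y Z K Q W : C.

Definition is_iso X Y (f : hom X Y) : Prop :=
  exists g : hom Y X, g \oc f = idm X /\ f \oc g = idm Y.

Definition isomorphic X Y : Prop := exists f : hom X Y, is_iso f.

Definition is_mono X Y (f : hom X Y) : Prop :=
  forall W (u v : hom W X), f \oc u = f \oc v -> u = v.

Definition is_epi X Y (f : hom X Y) : Prop :=
  forall W (u v : hom Y W), u \oc f = v \oc f -> u = v.

Definition is_zero X : Prop := idm X = 0.

Definition is_kernel X Y (f : hom X Y) K (k : hom K X) : Prop :=
  f \oc k = 0 /\
  forall W (w : hom W X), f \oc w = 0 -> exists! u : hom W K, k \oc u = w.

Definition is_cokernel X Y (f : hom X Y) Q (q : hom Y Q) : Prop :=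
  q \oc f = 0 /\
  forall W (w : hom Y W), w \oc f = 0 -> exists! u : hom Q W, u \oc q = w.

Definition is_direct_sum n (W : 'I_n -> C) Z : Prop :=
  exists (inj : forall k, hom (W k) Z) (prj : forall k, hom Z (W k)),
    [/\ forall k, prj k \oc inj k = idm (W k),
        forall k l, k != l -> prj k \oc inj l = 0
      & \sum_k inj k \oc prj k = idm Z].

(* For n = 0 the first clause provides a zero object. *)
Definition abelian_category : Prop :=
  [/\ forall n (W : 'I_n -> C), exists Z, is_direct_sum W Z,
      forall X Y (f : hom X Y), exists K (k : hom K X), is_kernel f k,
      forall X Y (f : hom X Y), exists Q (q : hom Y Q), is_cokernel f q,
      forall X Y (f : hom X Y), is_mono f ->
        exists Z (g : hom Y Z), is_kernel g f
    & forall X Y (f : hom X Y), is_epi f ->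
        exists Z (g : hom Z X), is_cokernel g f].

(* X is nonzero and has no subobjects other than 0 and X. *)
Definition simple_object X : Prop :=
  ~ is_zero X /\
  forall Y (f : hom Y X), is_mono f -> is_zero Y \/ is_iso f.

Definition semisimple_category : Prop :=
  forall X, exists n (W : 'I_n -> C),
    (forall k, simple_object (W k)) /\ is_direct_sum W X.

(* V lists the simple objects up to isomorphism, each exactly once. *)
Definition lists_simples r (V : 'I_r -> C) : Prop :=
  [/\ forall i, simple_object (V i),
      forall i j, isomorphic (V i) (V j) -> i = j
    & forall X, simple_object X -> exists i, isomorphic X (V i)].

End AbelianCategories.

(* A linear, braided monoidal category with (left) duals and a compatible
   twist. Neither associativity nor the unit laws are assumed strict. Right
   duals need not be given: they are obtained from the left duals and the
   braiding. The inverses of the structural isomorphisms are uniquely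
   determined, and are fields only so that they have a name. *)
Record ribbonCategory (R : realType) := RibbonCategory {
  ribbon_linear :> linearCategory R;

  tens : ribbon_linear -> ribbon_linear -> ribbon_linear;
  tensm : forall X X' Y Y' : ribbon_linear,
    hom X X' -> hom Y Y' -> hom (tens X Y) (tens X' Y');
  tensm_id : forall X Y : ribbon_linear,
    tensm (idm X) (idm Y) = idm (tens X Y);
  tensm_comp : forall (X X' X'' Y Y' Y'' : ribbon_linear)
      (f' : hom X' X'') (f : hom X X') (g' : hom Y' Y'') (g : hom Y Y'),
    tensm (f' \oc f) (g' \oc g) = tensm f' g' \oc tensm f g;
  tensm_linl : forall (X X' Y Y' : ribbon_linear)
      (g : hom Y Y') (a : R[i]) (f f' : hom X X'),
    tensm (a *: f + f') g = a *: tensm f g + tensm f' g;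
  tensm_linr : forall (X X' Y Y' : ribbon_linear)
      (f : hom X X') (a : R[i]) (g g' : hom Y Y'),
    tensm f (a *: g + g') = a *: tensm f g + tensm f g';

  unit_obj : ribbon_linear;
  assoc : forall X Y Z, hom (tens (tens X Y) Z) (tens X (tens Y Z));
  associ : forall X Y Z, hom (tens X (tens Y Z)) (tens (tens X Y) Z);
  lunit : forall X, hom (tens unit_obj X) X;
  luniti : forall X, hom X (tens unit_obj X);
  runit : forall X, hom (tens X unit_obj) X;
  runiti : forall X, hom X (tens X unit_obj);
  assocK : forall X Y Z, associ X Y Z \oc assoc X Y Z = idm _;
  associK : forall X Y Z, assoc X Y Z \oc associ X Y Z = idm _;
  lunitK : forall X, luniti X \oc lunit X = idm _;
  lunitiK : forall X, lunit X \oc luniti X = idm _;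
  runitK : forall X, runiti X \oc runit X = idm _;
  runitiK : forall X, runit X \oc runiti X = idm _;
  assoc_natural : forall (X X' Y Y' Z Z' : ribbon_linear)
      (f : hom X X') (g : hom Y Y') (h : hom Z Z'),
    assoc X' Y' Z' \oc tensm (tensm f g) h
      = tensm f (tensm g h) \oc assoc X Y Z;
  lunit_natural : forall (X X' : ribbon_linear) (f : hom X X'),
    lunit X' \oc tensm (idm unit_obj) f = f \oc lunit X;
  runit_natural : forall (X X' : ribbon_linear) (f : hom X X'),
    runit X' \oc tensm f (idm unit_obj) = f \oc runit X;
  pentagon : forall X Y Z W : ribbon_linear,
    assoc X Y (tens Z W) \oc assoc (tens X Y) Z W
      = tensm (idm X) (assoc Y Z W) \oc assoc X (tens Y Z) W
          \oc tensm (assoc X Y Z) (idm W);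
  triangle : forall X Y : ribbon_linear,
    tensm (idm X) (lunit Y) \oc assoc X unit_obj Y = tensm (runit X) (idm Y);

  braid : forall X Y, hom (tens X Y) (tens Y X);
  braidi : forall X Y, hom (tens Y X) (tens X Y);
  braidK : forall X Y, braidi X Y \oc braid X Y = idm _;
  braidiK : forall X Y, braid X Y \oc braidi X Y = idm _;
  braid_natural : forall (X X' Y Y' : ribbon_linear)
      (f : hom X X') (g : hom Y Y'),
    braid X' Y' \oc tensm f g = tensm g f \oc braid X Y;
  hexagonr : forall X Y Z : ribbon_linear,
    assoc Y Z X \oc braid X (tens Y Z) \oc assoc X Y Z
      = tensm (idm Y) (braid X Z) \oc assoc Y X Z
          \oc tensm (braid X Y) (idm Z);
  hexagonl : forall X Y Z : ribbon_linear,
    associ Z X Y \oc braid (tens X Y) Z \oc associ X Y Z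
      = tensm (braid X Z) (idm Y) \oc associ X Z Y
          \oc tensm (idm X) (braid Y Z);

  dual : ribbon_linear -> ribbon_linear;
  ev : forall X, hom (tens (dual X) X) unit_obj;
  coev : forall X, hom unit_obj (tens X (dual X));
  zigzag : forall X,
    runit X \oc tensm (idm X) (ev X) \oc assoc X (dual X) X
      \oc tensm (coev X) (idm X) \oc luniti X = idm X;
  zigzag_dual : forall X,
    lunit (dual X) \oc tensm (ev X) (idm (dual X))
      \oc associ (dual X) X (dual X)
      \oc tensm (idm (dual X)) (coev X) \oc runiti (dual X) = idm (dual X);

  twist : forall X, hom X X;
  twist_iso : forall X, is_iso (twist X);
  twist_natural : forall (X Y : ribbon_linear) (f : hom X Y),
    twist Y \oc f = f \oc twist X;
  twist_tens : forall X Y : ribbon_linear,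
    twist (tens X Y)
      = braid Y X \oc braid X Y \oc tensm (twist X) (twist Y);
  (* The right-hand side is the transpose of twist X. *)
  twist_dual : forall X,
    twist (dual X)
      = lunit (dual X) \oc tensm (ev X) (idm (dual X))
          \oc tensm (tensm (idm (dual X)) (twist X)) (idm (dual X))
          \oc associ (dual X) X (dual X)
          \oc tensm (idm (dual X)) (coev X) \oc runiti (dual X)
}.

Arguments unit_obj {R} r : rename.
Arguments tens {R r} X Y : rename.
Arguments tensm {R r X X' Y Y'} f g : rename.
Arguments braid {R r} X Y : rename.
Arguments dual {R r} X : rename.
Arguments ev {R r} X : rename.
Arguments coev {R r} X : rename.
Arguments twist {R r} X : rename.

Section Modular.
Variables (R : realType) (C : ribbonCategory R).

Definition fusion_category : Prop :=
  [/\ abelian_category C, semisimple_category C, simple_object (unit_obj C)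
    & exists r (V : 'I_r -> C), lists_simples V].

Definition qtrace (X : C) (f : hom X X) : hom (unit_obj C) (unit_obj C) :=
  ev X \oc braid X (dual X) \oc tensm (twist X \oc f) (idm (dual X))
    \oc coev X.

(* The coordinate of f on id_1. When the unit object is simple,
   f = unit_scalar f *: id_1. *)
Definition unit_scalar (f : hom (unit_obj C) (unit_obj C)) : R[i] :=
  coord [tuple idm (unit_obj C)] ord0 f.

(* The dual of V i occurs here, so that
   theta_i theta_j S_ij = sum_k N_(i^* j)^k d_k theta_k. *)
Definition Smatrix r (V : 'I_r -> C) : 'M[R[i]]_r :=
  \matrix_(i, j) unit_scalar
    (qtrace (braid (V j) (dual (V i)) \oc braid (dual (V i)) (V j))).

(* The S-matrix is invertible; this does not depend on the labelling. *)
Definition nondegenerate : Prop :=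
  forall r (V : 'I_r -> C), lists_simples V -> Smatrix V \in unitmx.

End Modular.

Record modularCategory (R : realType) := ModularCategory {
  modular_ribbon :> ribbonCategory R;
  modular_fusion : fusion_category modular_ribbon;
  modular_nondegenerate : nondegenerate modular_ribbon
}.

Section Labelled.
Variables (R : realType) (C : modularCategory R) (n : nat).
Variable V : 'I_n.+1 -> C.

(* A labelling by 0, ..., n of the simple objects, the label of the unit
   object being 0; in particular C has rank n.+1. *)
Definition labelling : Prop :=
  lists_simples V /\ isomorphic (V ord0) (unit_obj C).

Definition self_dual : Prop := forall i, isomorphic (dual (V i)) (V i).

Definition fusion_mult (i j k : 'I_n.+1) : nat :=
  \dim {: hom (tens (V i) (V j)) (V k)}.

Definition fusion_matrix (i : 'I_n.+1) : 'M[R]_n.+1 :=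
  \matrix_(j, k) (fusion_mult i j k)%:R.

Definition is_FPdim (i : 'I_n.+1) (x : R) : Prop :=
  [/\ 0 <= x, eigenvalue (fusion_matrix i) x
    & forall y : R, eigenvalue (fusion_matrix i) y -> y <= x].

Definition integral : Prop := forall i, exists m : int, is_FPdim i m%:~R.

Definition eigenvalue_matrix : 'M[R[i]]_n.+1 :=
  \matrix_(i, j) (Smatrix V i j / Smatrix V ord0 j).

(* Membership in Q(S), the smallest subfield of the complex numbers containing
   the entries of S. *)
Definition in_QS (x : R[i]) : Prop :=
  forall K : {pred R[i]}, GRing.divring_closed K ->
    (forall i j, Smatrix V i j \in K) -> x \in K.

(* phi restricts to an automorphism of the field Q(S); the values of phi outside
   of Q(S) are irrelevant. Such a restriction is injective, and fixes Q. *)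
Definition is_automorphism_QS (phi : R[i] -> R[i]) : Prop :=
  [/\ forall x, in_QS x -> in_QS (phi x),
      forall y, in_QS y -> exists2 x, in_QS x & phi x = y,
      phi 1 = 1,
      forall x y, in_QS x -> in_QS y -> phi (x + y) = phi x + phi y
    & forall x y, in_QS x -> in_QS y -> phi (x * y) = phi x * phi y].

Definition galois_image : {set 'S_n.+1} :=
  [set p : 'S_n.+1 | `[< exists2 phi, is_automorphism_QS phi &
     forall i j, phi (eigenvalue_matrix i j) = eigenvalue_matrix i (p j) >]].

End Labelled.

(* Products of permutations are evaluated from left to right. *)
Definition cycle0123 : 'S_6 :=
  (tperm (inord 0) (inord 1) * tperm (inord 0) (inord 2)
     * tperm (inord 0) (inord 3))%g.

Lemma cycle0123E :
  [seq val (cycle0123 (inord k)) | k <- iota 0 6] = [:: 1; 2; 3; 0; 4; 5]%N.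
Proof.
have inordE k l : (k < 6)%N -> (l < 6)%N ->
  ((inord k : 'I_6) == inord l) = (k == l).
  by move=> hk hl; rewrite -val_eqE /= !inordK.
rewrite /= /cycle0123 !permM !permE /= !inordE //=.
by rewrite !inordK.
Qed.

(* Main.v *)
Require Import Defs.
From HB Require Import structures.
From mathcomp Require Import all_boot all_order all_algebra all_fingroup.
From mathcomp Require Import boolp reals complex spectral ring.
Import Defs.

(* Write sigma = (0123) for a generator of G, d for the dimensions, u = d_4 and
   v = d_5. Since S_ij = s_ij d_j is symmetric, so is
   sigma(S_ij) = s_(i, sigma j) s_(j, sigma 0). It follows that, up to signs of
   rows and columns, S consists of a circulant block (y_(i+j)), i, j in Z/4,
   bordered by the rows u (1, 1, 1, 1) and v (1, k, 1, k) with k = +-1, and of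
   a 2 x 2 block whose quotients by u and v are fixed by sigma; moreover sigma
   maps y_i, u, v to y_(i+1) / y_1, u / y_1, k v / y_1.

   If k = 1, the equation S^2 = D^2 gives 2 c Z = +- (b^2 + c^2 + 4) u, where
   Z = y_0 - y_1 + y_2 - y_3, b = s_54 and c = s_45 <> 0. As sigma maps Z to
   - Z / y_1 and u to u / y_1, this forces Z = 0, against Z^2 = D^2.

   If k = -1, the modular relation between S and T, read on a few entries,
   leaves only u^2 = v^2 or y_2 = 1. In the former case applying sigma to
   u = +- v gives u = -+ v; in the latter it gives y_3 = y_1, and then two
   entries of S^2 = D^2 yield D^2 = 0.

   These identities hold because s_ij is the scalar by which a loop labelled i
   around a strand labelled j acts: such scalars are multiplicative in the
   loop, so that the columns of s are characters of the fusion ring, and the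
   balancing axiom expresses S through the twists and the fusion
   multiplicities. *)

Set Implicit Arguments.
Unset Strict Implicit.
Unset Printing Implicit Defensive.

Import Num.Theory GRing.Theory VectorInternalTheory.
Local Open Scope ring_scope.
Local Open Scope cat_scope.

(* Composites are written in diagrammatic order and kept nested to the left. *)
Local Notation "f >> g" := (mcomp g f)
  (at level 50, left associativity, only parsing) : cat_scope.
Local Notation "f >> g" := (mcomp g f)
  (at level 50, left associativity, format "f  >>  g", only printing) :
    cat_scope.
Local Notation "X \ox Y" := (tens X Y)
  (at level 35, right associativity) : cat_scope.
Local Notation lw X f := (tensm (idm X) f).
Local Notation rw f A := (tensm f (idm A)).

(** * Linear categories *)

Section LinearCategory.
Variables (R : realType) (C : linearCategory R).
Implicit Types X Y Z W : C.

(* An equation f >> g = h in a form that rewrites inside a composite nested to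
   the left; similarly for comp3 and comp4. *)
Lemma comp2 X Y Z (f : hom X Y) (g : hom Y Z) (h : hom X Z) (e : f >> g = h) W
    (t : hom W X) : t >> f >> g = t >> h.
Proof. by rewrite mcompA e. Qed.

Lemma comp3 X Y Z Z' (f : hom X Y) (g : hom Y Z) (g' : hom Z Z') (h : hom X Z')
    (e : f >> g >> g' = h) W (t : hom W X) : t >> f >> g >> g' = t >> h.
Proof. by rewrite -e -?mcompA. Qed.

Lemma comp4 X Y Z Z' U (f : hom X Y) (g : hom Y Z) (g' : hom Z Z')
    (g'' : hom Z' U) (h : hom X U) (e : f >> g >> g' >> g'' = h) W
    (t : hom W X) : t >> f >> g >> g' >> g'' = t >> h.
Proof. by rewrite -e -!mcompA. Qed.

Lemma mcompDl X Y Z (f : hom X Y) (g g' : hom Y Z) :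
  f >> (g + g') = (f >> g) + (f >> g').
Proof. by have := mcomp_linl f 1 g g'; rewrite !scale1r. Qed.

Lemma mcompDr X Y Z (f f' : hom X Y) (g : hom Y Z) :
  (f + f') >> g = (f >> g) + (f' >> g).
Proof. by have := mcomp_linr g 1 f f'; rewrite !scale1r. Qed.

Lemma mcomp0l X Y Z (f : hom X Y) : f >> (0 : hom Y Z) = 0.
Proof. by apply: (addrI (f >> 0)); rewrite -mcompDl !addr0. Qed.

Lemma mcomp0r X Y Z (g : hom Y Z) : (0 : hom X Y) >> g = 0.
Proof. by apply: (addrI (0 >> g)); rewrite -mcompDr !addr0. Qed.

Lemma mcompZl X Y Z (f : hom X Y) a (g : hom Y Z) :
  f >> (a *: g) = a *: (f >> g).
Proof. by have := mcomp_linl f a g 0; rewrite mcomp0l !addr0. Qed.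

Lemma mcompZr X Y Z (f : hom X Y) a (g : hom Y Z) :
  (a *: f) >> g = a *: (f >> g).
Proof. by have := mcomp_linr g a f 0; rewrite mcomp0r !addr0. Qed.

Lemma mcomp_sumr X Y Z (g : hom Y Z) n (f : 'I_n -> hom X Y) :
  (\sum_k f k) >> g = \sum_k (f k >> g).
Proof. exact: (big_morph _ (fun f f' => mcompDr f f' g) (mcomp0r X g)). Qed.

Lemma mcomp_suml X Y Z (f : hom X Y) n (g : 'I_n -> hom Y Z) :
  f >> (\sum_k g k) = \sum_k (f >> g k).
Proof. exact: (big_morph _ (mcompDl f) (mcomp0l Z f)). Qed.

End LinearCategory.

(** * Coherence *)

Section MonoidalCalculus.
Variables (R : realType) (C : ribbonCategory R).
Implicit Types X Y Z W A B : C.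

Lemma lwM X Y Z W (f : hom Y Z) (g : hom Z W) :
  lw X (f >> g) = lw X f >> lw X g.
Proof. by rewrite -tensm_comp mcomp_idl. Qed.

Lemma rwM A X Y Z (f : hom X Y) (g : hom Y Z) :
  rw (f >> g) A = rw f A >> rw g A.
Proof. by rewrite -tensm_comp mcomp_idl. Qed.

Lemma rw_lw X Y A B (f : hom X Y) (g : hom A B) :
  rw f A >> lw Y g = lw X g >> rw f B.
Proof. by rewrite -!tensm_comp !mcomp_idl !mcomp_idr. Qed.

Lemma lw2 X Y Z W (f : hom Y Z) (g : hom Z W) h (e : f >> g = h) :
  lw X f >> lw X g = lw X h.
Proof. by rewrite -lwM e. Qed.

Lemma rw2 A X Y Z (f : hom X Y) (g : hom Y Z) h (e : f >> g = h) :
  rw f A >> rw g A = rw h A.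
Proof. by rewrite -rwM e. Qed.

Lemma lw22 X Y Z Z' W (f : hom Y Z) (g : hom Z W) (f' : hom Y Z')
    (g' : hom Z' W) (e : f >> g = f' >> g') :
  lw X f >> lw X g = lw X f' >> lw X g'.
Proof. by rewrite -!lwM e. Qed.

Lemma lw32 X Y Z Z' U W (f : hom Y Z) (f' : hom Z Z') (g : hom Z' W)
    (h : hom Y U) (h' : hom U W) (e : f >> f' >> g = h >> h') :
  lw X f >> lw X f' >> lw X g = lw X h >> lw X h'.
Proof. by rewrite -!lwM e. Qed.

Lemma lw3 X Y Z Z' W (f : hom Y Z) (f' : hom Z Z') (g : hom Z' W)
    (h : hom Y W) (e : f >> f' >> g = h) :
  lw X f >> lw X f' >> lw X g = lw X h.
Proof. by rewrite -!lwM e. Qed.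

Arguments lw2 {X Y Z W f g h} e.
Arguments rw2 {A X Y Z f g h} e.
Arguments lw22 {X Y Z Z' W f g f' g'} e.

Lemma lwDr X Y Z (f g : hom Y Z) : lw X (f + g) = lw X f + lw X g.
Proof. by have := tensm_linr (idm X) 1 f g; rewrite !scale1r. Qed.
Lemma rwDl A X Y (f g : hom X Y) : rw (f + g) A = rw f A + rw g A.
Proof. by have := tensm_linl (idm A) 1 f g; rewrite !scale1r. Qed.
Lemma lw0 X Y Z : lw X (0 : hom Y Z) = 0.
Proof. by apply: (addrI (lw X 0)); rewrite -lwDr !addr0. Qed.
Lemma rw0 A X Y : rw (0 : hom X Y) A = 0.
Proof. by apply: (addrI (rw 0 A)); rewrite -rwDl !addr0. Qed.
Lemma lwZ X Y Z a (f : hom Y Z) : lw X (a *: f) = a *: lw X f.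
Proof. by have := tensm_linr (idm X) a f 0; rewrite lw0 !addr0. Qed.
Lemma rwZ A X Y a (f : hom X Y) : rw (a *: f) A = a *: rw f A.
Proof. by have := tensm_linl (idm A) a f 0; rewrite rw0 !addr0. Qed.

Lemma epiE X Y Z (f : hom X Y) (f' : hom Y X) (g h : hom Y Z) :
  f' >> f = idm Y -> f >> g = f >> h -> g = h.
Proof.
move=> ff e; rewrite -[g]mcomp_idr -[h]mcomp_idr -ff.
by rewrite !mcompA e.
Qed.

Lemma monoE X Y Z (f : hom Y Z) (f' : hom Z Y) (g h : hom X Y) :
  f >> f' = idm Y -> g >> f = h >> f -> g = h.
Proof.
move=> ff e; rewrite -[g]mcomp_idl -[h]mcomp_idl -ff.
by rewrite -?mcompA e.
Qed.

Lemma isoK X Y (f : hom X Y) (f' : hom Y X) (e : f >> f' = idm X) W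
   (t : hom W X) : t >> f >> f' = t.
Proof. by rewrite mcompA e mcomp_idl. Qed.

Lemma pentagonE X Y Z W :
  rw (assoc X Y Z) W >> assoc X (Y \ox Z) W >> lw X (assoc Y Z W) =
  assoc (X \ox Y) Z W >> assoc X Y (Z \ox W).
Proof. by rewrite pentagon -?mcompA. Qed.

Lemma lw1_inj A B (f g : hom A B) :
  lw (unit_obj C) f = lw (unit_obj C) g -> f = g.
Proof.
move=> e; apply: (epiE (lunitiK A)).
by rewrite -!lunit_natural e.
Qed.

Lemma assoc_nat3 X Y A B (f : hom A B) :
  lw (X \ox Y) f >> assoc X Y B = assoc X Y A >> lw X (lw Y f).
Proof. by rewrite -tensm_id assoc_natural. Qed.

Lemma assoc_nat1 X Y A B (f : hom X Y) :
  rw (rw f A) B >> assoc Y A B = assoc X A B >> rw f (A \ox B).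
Proof. by rewrite assoc_natural tensm_id. Qed.

Lemma assoc_nat2 X A B W (f : hom A B) :
  rw (lw X f) W >> assoc X B W = assoc X A W >> lw X (rw f W).
Proof. by rewrite assoc_natural. Qed.

(** Kelly's argument: tensoring with the unit on the left is faithful by [lw1_inj], and after it the
    equation follows from the pentagon and two triangles. *)
Lemma lunit_tens A B :
  assoc (unit_obj C) A B >> lunit (A \ox B) = rw (lunit A) B.
Proof.
set I := unit_obj C; apply: lw1_inj; rewrite lwM.
apply: (epiE (f := rw (assoc I I A) B >> assoc I (I \ox A) B)
  (f' := associ I (I \ox A) B >> rw (associ I I A) B)).
  by rewrite -?mcompA (comp2 (rw2 (associK _ _ _))) tensm_id mcomp_idl associK.
rewrite -?mcompA pentagonE (comp2 (triangle _ _)) -assoc_nat1.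
rewrite mcompA -assoc_nat2 -mcompA -!rwM.
by rewrite triangle.
Qed.

Lemma assoc_epi X Y Z W (g h : hom (X \ox Y \ox Z) W) :
  assoc X Y Z >> g = assoc X Y Z >> h -> g = h.
Proof. exact: epiE (associK X Y Z). Qed.

Lemma rw_epi X Y A W (f : hom X Y) (f' : hom Y X) (g h : hom (Y \ox A) W) :
  f' >> f = idm Y -> rw f A >> g = rw f A >> h -> g = h.
Proof.
move=> e; apply: (epiE (f' := rw f' A)).
by rewrite -rwM e tensm_id.
Qed.

Lemma lw_epi X Y A W (f : hom X Y) (f' : hom Y X) (g h : hom (A \ox Y) W) :
  f' >> f = idm Y -> lw A f >> g = lw A f >> h -> g = h.
Proof.
move=> e; apply: (epiE (f' := lw A f')).
by rewrite -lwM e tensm_id.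
Qed.

Lemma luniti_natural X Y (f : hom X Y) :
  f >> luniti Y = luniti X >> lw (unit_obj C) f.
Proof.
apply: (epiE (lunitiK X)); rewrite -mcompA -lunit_natural.
by rewrite (isoK (lunitK _)) -?mcompA lunitK mcomp_idr.
Qed.

(* The braiding, evaluation and coevaluation, whiskered with an object on the
   right. They are locked because rewriting with mcompA would unfold them. *)
Definition br X Y A : hom (X \ox Y \ox A) (Y \ox X \ox A) :=
  locked (associ X Y A >> rw (braid X Y) A >> assoc Y X A).

Definition evF X A : hom (dual X \ox X \ox A) A :=
  locked (associ _ _ _ >> rw (ev X) A >> lunit A).

Definition coevF X A : hom A (X \ox dual X \ox A) :=
  locked (luniti A >> rw (coev X) A >> assoc _ _ _).

Lemma brE X Y A : assoc X Y A >> br X Y A = rw (braid X Y) A >> assoc Y X A.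
Proof. by rewrite /br -lock -?mcompA assocK mcomp_idr. Qed.

Lemma evFE X A : assoc (dual X) X A >> evF X A = rw (ev X) A >> lunit A.
Proof. by rewrite /evF -lock -?mcompA assocK mcomp_idr. Qed.

Lemma coevFE X A : coevF X A = luniti A >> rw (coev X) A >> assoc _ _ _.
Proof. by rewrite /coevF -lock. Qed.

Lemma br_nat X Y A B (f : hom A B) :
  lw X (lw Y f) >> br X Y B = br X Y A >> lw Y (lw X f).
Proof.
apply: assoc_epi; rewrite -?mcompA -assoc_nat3 brE (comp2 (brE _ _ _)).
by rewrite -?mcompA -rw_lw (comp2 (assoc_nat3 _ _ _)) -?mcompA.
Qed.

Lemma br_natl X X' Y A (f : hom X X') :
  rw f (Y \ox A) >> br X' Y A = br X Y A >> lw Y (rw f A).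
Proof.
apply: assoc_epi; rewrite -?mcompA -assoc_nat1 brE (comp2 (brE _ _ _)).
by rewrite -?mcompA -!rwM (comp2 (esym (assoc_nat2 _ _ _))) -?mcompA
  -rwM braid_natural.
Qed.

Lemma br_natr X Y Y' A (f : hom Y Y') :
  lw X (rw f A) >> br X Y' A = br X Y A >> rw f (X \ox A).
Proof.
apply: assoc_epi; rewrite -?mcompA -assoc_nat2 brE (comp2 (brE _ _ _)).
by rewrite -?mcompA -!rwM (comp2 (esym (assoc_nat1 _ _ _))) -?mcompA
  -rwM braid_natural.
Qed.

Lemma evF_nat X A B (f : hom A B) :
  lw (dual X) (lw X f) >> evF X B = evF X A >> f.
Proof.
apply: assoc_epi; rewrite -?mcompA -assoc_nat3 evFE (comp2 (evFE _ _)).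
by rewrite -?mcompA -rw_lw (comp2 (lunit_natural _)) -?mcompA.
Qed.

Lemma coevF_nat X A B (f : hom A B) :
  f >> coevF X B = coevF X A >> lw X (lw (dual X) f).
Proof.
rewrite !coevFE -?mcompA luniti_natural (comp2 (esym (rw_lw _ _))).
by rewrite -?mcompA (comp2 (esym (assoc_nat3 _ _ _))) -?mcompA.
Qed.

(** By the pentagon, whiskering a whiskered braiding again is, up to associators, whiskering with a
    tensor product; [evF_mod] and [coevF_mod] are the analogues for duality. *)
Lemma br_mod X Y A B :
  rw (br X Y A) B >> assoc Y (X \ox A) B >> lw Y (assoc X A B) =
  assoc X (Y \ox A) B >> lw X (assoc Y A B) >> br X Y (A \ox B).
Proof.
apply: (rw_epi (associK X Y A)); rewrite -?mcompA pentagonE.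
rewrite -rwM brE rwM (comp3 (pentagonE _ _ _ _)) (comp2 (brE _ _ _)).
by rewrite -?mcompA assoc_nat1.
Qed.

Lemma evF_mod X A B :
  rw (evF X A) B =
  assoc _ (X \ox A) B >> lw _ (assoc X A B) >> evF X (A \ox B).
Proof.
apply: (rw_epi (associK (dual X) X A)); rewrite -?mcompA pentagonE.
rewrite -rwM evFE rwM (comp2 (evFE _ _)) -?mcompA.
by rewrite -assoc_nat1 -lunit_tens -?mcompA.
Qed.

Lemma coevF_mod X A B :
  rw (coevF X A) B >> assoc X _ B >> lw X (assoc _ A B) = coevF X (A \ox B).
Proof.
rewrite !coevFE !rwM (comp3 (pentagonE _ _ _ _)) -?mcompA.
rewrite (comp2 (assoc_nat1 _ _ _)) -?mcompA; congr (_ >> _ >> _).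
apply: (monoE (lunitK (A \ox B))).
rewrite -?mcompA (comp2 (lunit_tens _ _)).
by rewrite lunitiK -rwM lunitiK tensm_id.
Qed.

Lemma coevF_evF X A : coevF X (X \ox A) >> lw X (evF X A) = idm (X \ox A).
Proof.
rewrite -coevF_mod coevFE !rwM -?mcompA.
rewrite (comp2 (lw22 (evFE X A))) -?mcompA
  (comp2 (esym (assoc_nat2 _ _ _))) -?mcompA.
rewrite (comp2 (triangle _ _)) -!rwM; have := zigzag X.
by rewrite -?mcompA => ->; rewrite tensm_id.
Qed.

Lemma lw_luniti X A :
  lw X (luniti A) = rw (runiti X) A >> assoc X (unit_obj C) A.
Proof.
have e : lw X (lunit A) >> lw X (luniti A) = idm _.
  by rewrite -lwM lunitK tensm_id.
apply: (monoE (f := lw X (lunit A)) (f' := lw X (luniti A)) e).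
by rewrite -lwM lunitiK tensm_id mcompA triangle -rwM runitiK tensm_id.
Qed.

Lemma evF_coevF X A :
  lw (dual X) (coevF X A) >> evF X (dual X \ox A) = idm (dual X \ox A).
Proof.
rewrite coevFE !lwM lw_luniti (comp2 (esym (assoc_nat2 _ _ _))) -?mcompA.
rewrite (comp3 (esym (evF_mod _ _ _))) -!rwM; have := zigzag_dual X.
by rewrite /evF -lock -?mcompA => ->; rewrite tensm_id.
Qed.

(** The hexagon [hexagonr] in whiskered form; the rest is pentagons and naturality. *)
Lemma br_tensr X Y Z A :
  br X (Y \ox Z) A >> assoc Y Z (X \ox A) =
  lw X (assoc Y Z A) >> br X Y (Z \ox A) >> lw Y (br X Z A).
Proof.
apply: assoc_epi; apply: (rw_epi (associK X Y Z)).
rewrite -?mcompA pentagonE (comp2 (brE _ _ _)) -?mcompA.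
rewrite (comp2 (brE _ _ _)) -?mcompA -assoc_nat1.
rewrite (comp2 (esym (pentagonE _ _ _ _))) -?mcompA.
rewrite (comp2 (esym (pentagonE _ _ _ _))) -?mcompA.
rewrite (comp2 (lw22 (brE _ _ _))) -?mcompA (comp2 (esym (assoc_nat2 _ _ _))).
rewrite -?mcompA -!rwM; congr (_ >> _ >> _); congr (rw _ _).
by rewrite mcompA hexagonr -?mcompA.
Qed.

Lemma hexagonlE X Y Z :
  braid (X \ox Y) Z =
  assoc X Y Z >> lw X (braid Y Z) >> associ X Z Y >> rw (braid X Z) Y
    >> assoc Z X Y.
Proof.
have := hexagonl X Y Z;
  rewrite -?mcompA => /(congr1 (fun f => f >> assoc Z X Y)).
rewrite -?mcompA (mcompA (assoc _ _ _)) associK mcomp_idl.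
move/(congr1 (fun f => assoc X Y Z >> f)).
by rewrite -?mcompA assocK mcomp_idr.
Qed.

Lemma br_tensl X Y W A :
  br (X \ox Y) W A >> lw W (assoc X Y A) =
  assoc X Y (W \ox A) >> lw X (br Y W A) >> br X W (Y \ox A).
Proof.
apply: assoc_epi.
rewrite -?mcompA brE hexagonlE !rwM -?mcompA (comp3 (pentagonE _ _ _ _)).
rewrite -?mcompA -(pentagonE X Y W A).
rewrite (comp2 (lw22 (brE _ _ _))) -?mcompA (comp2 (esym (assoc_nat2 _ _ _))).
rewrite -?mcompA (comp2 (assoc_nat1 _ _ _)) -?mcompA (comp2 (esym (brE _ _ _))).
rewrite -?mcompA (comp2 (esym (pentagonE _ _ _ _))) -?mcompA.
by rewrite (comp2 (rw2 (associK _ _ _))) tensm_id mcomp_idl.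
Qed.

Definition bri X Y A : hom (Y \ox X \ox A) (X \ox Y \ox A) :=
  locked (associ Y X A >> rw (braidi X Y) A >> assoc X Y A).

Lemma brK X Y A : br X Y A >> bri X Y A = idm _.
Proof.
rewrite /br /bri -!lock -?mcompA (isoK (assocK _ _ _)).
rewrite (comp2 (rw2 (braidK _ _))) tensm_id mcomp_idl associK //.
Qed.

(* The endomorphisms U of Y (x) - are invertible, and idempotent by the hexagon
   for 1 (x) 1 = 1. *)
Lemma br_unit Y A : br Y (unit_obj C) A >> lunit (Y \ox A) = lw Y (lunit A).
Proof.
set I := unit_obj C.
pose U B := br Y I B >> lunit (Y \ox B).
pose Ui B := luniti (Y \ox B) >> bri Y I B.
have UK B : U B >> Ui B = idm _.
  by rewrite /U /Ui -?mcompA (isoK (lunitK _)) brK.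
have UU B : U (I \ox B) >> U B = lw Y (lunit (I \ox B)) >> U B.
  apply: (lw_epi (associK I I B)).
  rewrite /U -?mcompA -lwM lunit_tens br_natr -lunit_tens -?mcompA.
  by rewrite (comp2 (esym (lunit_natural _))) -?mcompA -br_tensr.
have U1 B : U (I \ox B) = lw Y (lunit (I \ox B)) by apply: monoE (UK B) (UU B).
apply: (lw_epi (f := lw I (lunit A)) (f' := lw I (luniti A))).
  by rewrite -lwM lunitiK tensm_id.
rewrite -?mcompA br_nat (comp2 (lunit_natural _)) -?mcompA.
by have := U1 A; rewrite /U => ->; rewrite -!lwM lunit_natural.
Qed.

(** A strand slides past an evaluation: the braiding is natural in [ev X], and [br_unit] removes the
    unit object that remains. *)
Lemma br_evF Y X A :
  br Y (dual X) (X \ox A) >> lw (dual X) (br Y X A) >> evF X (Y \ox A) =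
  lw Y (evF X A).
Proof.
apply: (lw_epi (associK (dual X) X A)).
rewrite -?mcompA -br_tensr (comp2 (evFE _ _)) -lwM evFE lwM -?mcompA.
by rewrite -br_natr mcompA br_unit.
Qed.

(** Naturality of the braiding of X past the tensor product of Y and Z, applied to [braid Y Z]. *)
Lemma yang_baxter X Y Z A :
  br X Y (Z \ox A) >> lw Y (br X Z A) >> br Y Z (X \ox A) =
  lw X (br Y Z A) >> br X Z (Y \ox A) >> lw Z (br X Y A).
Proof.
apply: (lw_epi (associK Y Z A)); rewrite -?mcompA -br_tensr.
rewrite (comp2 (brE _ _ _)) -?mcompA -br_natr (comp2 (br_tensr _ _ _ _)).
by rewrite (lw22 (brE Y Z A)) -?mcompA.
Qed.

End MonoidalCalculus.
Arguments lw2 {R C X Y Z W f g h} e.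
Arguments rw2 {R C A X Y Z f g h} e.
Arguments lw22 {R C X Y Z Z' W f g f' g'} e.
Arguments lw32 {R C X Y Z Z' U W f f' g h h'} e.
Arguments lw3 {R C X Y Z Z' W f f' g h} e.

(** * Duals and traces *)

Section DualPairs.
Variables (R : realType) (C : ribbonCategory R).
Implicit Types P Q X Y Z W A B : C.

(** A family that is natural and compatible with associators is determined by its member at the unit
    object, because A is the unit tensored with A. *)
Lemma family_rw X Y (phi : forall A, hom (X \ox A) (Y \ox A)) :
    (forall A B (f : hom A B), lw X f >> phi B = phi A >> lw Y f) ->
    (forall A B, rw (phi A) B >> assoc Y A B = assoc X A B >> phi (A \ox B)) ->
  forall A, phi A = rw (runiti X >> phi (unit_obj C) >> runit Y) A.
Proof.
move=> nat mod A; rewrite !rwM -(triangle Y A) -?mcompA (comp2 (mod _ _)).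
rewrite -?mcompA (comp2 (esym (nat _ _ _))) -?mcompA (comp2 (triangle _ _))
  -rwM.
by rewrite runitiK tensm_id mcomp_idr.
Qed.

(* P' is a left dual of P; the unit and the counit are given whiskered with an
   arbitrary object on the right, compatibly with the associators, so that
   composites need no rebracketing. *)
Record dual_pair P P' := DualPair {
  dpe : forall A, hom (P' \ox P \ox A) A;
  dpc : forall A, hom A (P \ox P' \ox A);
  dpe_nat : forall A B (f : hom A B),
    lw P' (lw P f) >> dpe B = dpe A >> f;
  dpc_nat : forall A B (f : hom A B),
    f >> dpc B = dpc A >> lw P (lw P' f);
  dpe_mod : forall A B, rw (dpe A) B =
    assoc P' (P \ox A) B >> lw P' (assoc P A B) >> dpe (A \ox B);
  dpc_mod : forall A B,
    rw (dpc A) B >> assoc P (P' \ox A) B >> lw P (assoc P' A B)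
      = dpc (A \ox B);
  dp_zig : forall A, dpc (P \ox A) >> lw P (dpe A) = idm (P \ox A);
  dp_zag : forall A, lw P' (dpc A) >> dpe (P' \ox A) = idm (P' \ox A)
}.

Definition dual_std X : dual_pair X (dual X) :=
  DualPair (@evF_nat _ _ X) (@coevF_nat _ _ X) (@evF_mod _ _ X)
    (@coevF_mod _ _ X) (@coevF_evF _ _ X) (@evF_coevF _ _ X).

Section Tensor.
Variables (X X' Y Y' : C) (dX : dual_pair X X') (dY : dual_pair Y Y').

(** Nested duality morphisms: the pair for X is the inner one in [e] and the outer one in [c]. *)
Let e A : hom ((Y' \ox X') \ox (X \ox Y) \ox A) A :=
  locked (assoc Y' X' _ >> lw Y' (lw X' (assoc X Y A)) >> lw Y' (dpe dX (Y \ox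
    A))
    >> dpe dY A).
Let c A : hom A ((X \ox Y) \ox (Y' \ox X') \ox A) :=
  locked (dpc dX A >> lw X (dpc dY (X' \ox A)) >> associ X Y (Y' \ox X' \ox A)
    >> lw (X \ox Y) (associ Y' X' A)).

Let eE A : e A = assoc Y' X' _ >> lw Y' (lw X' (assoc X Y A))
    >> lw Y' (dpe dX (Y \ox A)) >> dpe dY A.
Proof. by rewrite /e -lock. Qed.

Let cE A : c A >> lw (X \ox Y) (assoc Y' X' A) >> assoc X Y _ =
  dpc dX A >> lw X (dpc dY (X' \ox A)).
Proof.
rewrite /c -lock -?mcompA (comp2 (lw2 (associK _ _ _))) tensm_id mcomp_idl.
by rewrite (comp2 (associK _ _ _)) mcomp_idl.
Qed.

Let c_mono A W (g h : hom W ((X \ox Y) \ox (Y' \ox X') \ox A)) :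
  g >> lw (X \ox Y) (assoc Y' X' A) >> assoc X Y _ =
  h >> lw (X \ox Y) (assoc Y' X' A) >> assoc X Y _ -> g = h.
Proof.
move=> E; apply: (monoE (f := lw (X \ox Y) (assoc Y' X' A))
  (f' := lw (X \ox Y) (associ Y' X' A))).
  by rewrite -lwM assocK tensm_id.
exact: monoE (assocK _ _ _) E.
Qed.

Let e_nat A B (f : hom A B) :
  lw (Y' \ox X') (lw (X \ox Y) f) >> e B = e A >> f.
Proof.
rewrite !eE -?mcompA assoc_nat3 (comp2 (lw22 (lw22 (assoc_nat3 _ _ _))))
  -?mcompA.
rewrite (comp2 (lw22 (dpe_nat _ _))) -?mcompA.
by rewrite (comp2 (dpe_nat _ _)) -?mcompA.
Qed.

Let c_nat A B (f : hom A B) :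
  f >> c B = c A >> lw (X \ox Y) (lw (Y' \ox X') f).
Proof.
apply: c_mono; rewrite (comp3 (cE _)) -?mcompA.
rewrite (comp2 (lw22 (assoc_nat3 _ _ _))) -?mcompA.
rewrite (comp2 (assoc_nat3 _ _ _)) -?mcompA cE (dpc_nat dX).
by rewrite (comp2 (lw22 (dpc_nat _ _))) -?mcompA.
Qed.

Let e_mod A B : rw (e A) B =
  assoc _ _ B >> lw _ (assoc (X \ox Y) A B) >> e (A \ox B).
Proof.
rewrite !eE !rwM (dpe_mod dY) -?mcompA.
rewrite [in RHS](comp2 (assoc_nat3 _ _ _)) -?mcompA.
rewrite -(pentagonE Y' X' _ B).
rewrite [in LHS](comp2 (assoc_nat2 _ _ _)) -?mcompA (dpe_mod dX).
rewrite !lwM -?mcompA (comp2 (lw22 (esym (dpe_nat dX (assoc Y A B))))) -?mcompA.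
rewrite [in LHS](comp2 (assoc_nat2 _ _ _)) -?mcompA.
rewrite (comp2 (lw22 (assoc_nat2 _ _ _))) -?mcompA.
by rewrite (comp3 (lw32 (lw32 (pentagonE _ _ _ _)))) -?mcompA.
Qed.

Let c_mod A B : rw (c A) B >> assoc (X \ox Y) _ B >> lw _ (assoc _ A B)
  = c (A \ox B).
Proof.
apply: c_mono; rewrite cE.
rewrite (comp2 (lw22 (esym (pentagonE _ _ _ _)))) !lwM -?mcompA.
rewrite (comp2 (esym (assoc_nat2 _ _ _))) -?mcompA.
rewrite (comp2 (assoc_nat3 _ _ _)) -?mcompA (comp2 (assoc_nat3 _ _ _)) -?mcompA.
rewrite (comp2 (esym (pentagonE _ _ _ _))) -?mcompA -!rwM cE rwM.
rewrite (comp2 (assoc_nat2 _ _ _)) -?mcompA (comp3 (lw3 (dpc_mod dY _ _))).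
rewrite (comp2 (lw22 (esym (dpc_nat dY _)))) -?mcompA.
by rewrite (dpc_mod dX).
Qed.

Let zig A : c ((X \ox Y) \ox A) >> lw (X \ox Y) (e A) = idm _.
Proof.
apply: (monoE (assocK X Y A)); rewrite mcomp_idr.
rewrite eE !lwM -?mcompA.
do 3!rewrite (comp2 (assoc_nat3 _ _ _)) -?mcompA.
rewrite cE.
rewrite (comp2 (lw22 (esym (dpc_nat _ _)))) -?mcompA -dpc_nat.
rewrite (comp2 (lw22 (esym (dpc_nat _ _)))) -?mcompA (comp2 (lw2 (dp_zig _ _))).
by rewrite tensm_id mcomp_idl -?mcompA (comp2 (dp_zig _ _)) mcomp_idl.
Qed.

Let zag A : lw (Y' \ox X') (c A) >> e ((Y' \ox X') \ox A) = idm _.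
Proof.
apply: (monoE (assocK Y' X' A)); rewrite mcomp_idr.
rewrite eE -?mcompA.
rewrite assoc_nat3 (comp2 (esym (dpe_nat _ _))) -?mcompA.
rewrite (comp2 (lw22 (esym (dpe_nat _ _)))) -?mcompA.
rewrite (comp2 (lw22 (lw22 (esym (assoc_nat3 _ _ _))))) -?mcompA.
rewrite (comp3 (lw32 (lw32 (cE _)))) -?mcompA.
rewrite (comp2 (lw22 (dpe_nat _ _))) -?mcompA (comp2 (lw2 (dp_zag _ _))).
by rewrite tensm_id mcomp_idl (comp2 (dp_zag _ _)) mcomp_idl.
Qed.

Definition dual_tens : dual_pair (X \ox Y) (Y' \ox X') :=
  DualPair e_nat c_nat e_mod c_mod zig zag.

End Tensor.

Lemma dpe_tensE X X' Y Y' (dX : dual_pair X X') (dY : dual_pair Y Y') A :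
  dpe (dual_tens dX dY) A = assoc Y' X' _ >> lw Y' (lw X' (assoc X Y A))
    >> lw Y' (dpe dX (Y \ox A)) >> dpe dY A.
Proof. by rewrite /= -lock. Qed.

Lemma dpc_tensE X X' Y Y' (dX : dual_pair X X') (dY : dual_pair Y Y') A :
  dpc (dual_tens dX dY) A >> lw (X \ox Y) (assoc Y' X' A) >> assoc X Y _ =
  dpc dX A >> lw X (dpc dY (X' \ox A)).
Proof.
rewrite /= -lock -?mcompA (comp2 (lw2 (associK _ _ _))) tensm_id mcomp_idl.
by rewrite (comp2 (associK _ _ _)) mcomp_idl.
Qed.

(** * Transposes of morphisms *)

Section Mate.
Variables (P P' Q Q' : C) (dP : dual_pair P P') (dQ : dual_pair Q Q').
Variable p : hom P Q.

Let mateF A : hom (Q' \ox A) (P' \ox A) :=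
  lw Q' (dpc dP A) >> lw Q' (rw p (P' \ox A)) >> dpe dQ (P' \ox A).

(** The transpose of p, obtained by bending both ends of its strand; it is read off at the unit
    object, which suffices by [family_rw]. *)
Definition mate : hom Q' P' :=
  locked (runiti Q' >> mateF (unit_obj C) >> runit P').

Lemma rw_mate A :
  rw mate A =
  lw Q' (dpc dP A) >> lw Q' (rw p (P' \ox A)) >> dpe dQ (P' \ox A).
Proof.
rewrite /mate -lock -(@family_rw _ _ mateF) // => [A1 A2 f|A1 A2];
  rewrite /mateF.
  rewrite -?mcompA (lw22 (dpc_nat dP f)) (comp2 (lw22 (esym (rw_lw _ _)))).
  by rewrite -?mcompA (comp2 (dpe_nat dQ _)) -?mcompA.
rewrite !rwM (dpe_mod dQ) -?mcompA (comp2 (esym (dpe_nat dQ _))) -?mcompA.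
rewrite (comp2 (assoc_nat2 _ _ _)) -?mcompA.
rewrite (comp2 (lw22 (assoc_nat1 _ _ _))) -?mcompA.
rewrite (comp2 (lw22 (rw_lw p _))) -?mcompA.
rewrite (assoc_nat2 Q' _ (dpc dP A1)) -?mcompA.
by rewrite (comp3 (lw3 (dpc_mod dP _ _))) -?mcompA.
Qed.

Lemma dpc_mate A : dpc dP A >> rw p (P' \ox A) = dpc dQ A >> lw Q (rw mate A).
Proof.
rewrite rw_mate !lwM -?mcompA -dpc_nat (comp2 (esym (dpc_nat dQ _))) -?mcompA.
by rewrite (comp2 (dp_zig _ _)) mcomp_idl.
Qed.

Lemma dpe_mate A : rw mate (P \ox A) >> dpe dP A = lw Q' (rw p A) >> dpe dQ A.
Proof.
rewrite rw_mate -?mcompA (comp2 (esym (dpe_nat _ _))) -?mcompA.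
rewrite (comp2 (lw22 (rw_lw _ _))) -?mcompA (lw2 (dp_zig dP _)).
by rewrite tensm_id mcomp_idr.
Qed.

End Mate.

(* Together with dpc, closes a strand labelled P into a loop. *)
Definition clo P P' (dP : dual_pair P P') A : hom (P \ox P' \ox A) A :=
  locked (rw (twist P) (P' \ox A) >> br P P' A >> dpe dP A).

Lemma cloE P P' (dP : dual_pair P P') A :
  clo dP A = rw (twist P) (P' \ox A) >> br P P' A >> dpe dP A.
Proof. by rewrite /clo -lock. Qed.

Lemma clo_nat P P' (dP : dual_pair P P') A B (f : hom A B) :
  lw P (lw P' f) >> clo dP B = clo dP A >> f.
Proof.
rewrite !cloE -?mcompA -rw_lw (comp2 (br_nat _ _ _)) -?mcompA.
by rewrite (comp2 (dpe_nat _ _)) -?mcompA.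
Qed.

Lemma clo_mod P P' (dP : dual_pair P P') A B : rw (clo dP A) B =
  assoc P (P' \ox A) B >> lw P (assoc P' A B) >> clo dP (A \ox B).
Proof.
rewrite !cloE !rwM dpe_mod -?mcompA (comp3 (br_mod _ _ _ _)) -?mcompA.
by rewrite assoc_nat1 (comp2 (rw_lw _ _)) -?mcompA.
Qed.

Lemma clo_mate P P' Q Q' (dP : dual_pair P P') (dQ : dual_pair Q Q')
    (p : hom P Q) A :
  lw P (rw (mate dP dQ p) A) >> clo dP A = rw p (Q' \ox A) >> clo dQ A.
Proof.
rewrite !cloE -?mcompA -rw_lw (comp2 (br_natr _ _ _)) -?mcompA.
rewrite (comp2 (dpe_mate _ _ _ _)) -?mcompA (comp2 (esym (br_natl _ _ _))).
by rewrite -?mcompA -!rwM twist_natural.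
Qed.

Lemma twist_tensE X Y B :
  rw (twist (X \ox Y)) B >> assoc X Y B =
  assoc X Y B >> rw (twist X) (Y \ox B) >> lw X (rw (twist Y) B)
    >> br X Y B >> br Y X B.
Proof.
rewrite twist_tens !rwM -?mcompA (comp2 (esym (brE _ _ _))) -?mcompA.
rewrite (comp2 (esym (brE _ _ _))) -?mcompA; congr (_ >> _ >> _).
have -> : tensm (twist X) (twist Y) = rw (twist X) Y >> lw X (twist Y).
  by rewrite -tensm_comp mcomp_idl mcomp_idr.
by rewrite rwM -?mcompA (comp2 (assoc_nat2 _ _ _)) -?mcompA assoc_nat1.
Qed.

(** The twist of a tensor product contains a double braiding of X and Y. Yang-Baxter carries its
    crossings to the two evaluations, where [br_evF] absorbs them, so two parallel strands close to
    nested loops. *)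
Lemma clo_tens X Y A :
  clo (dual_tens (dual_std X) (dual_std Y)) A =
  lw (X \ox Y) (assoc _ _ A) >> assoc X Y _
    >> lw X (clo (dual_std Y) (dual X \ox A)) >> clo (dual_std X) A.
Proof.
rewrite cloE dpe_tensE -?mcompA /=.
rewrite (comp2 (br_tensr _ (dual Y) (dual X) A)) -?mcompA.
rewrite (comp2 (lw22 (br_tensl X Y (dual X) A))) !lwM -?mcompA.
rewrite (comp2 (br_tensl X Y (dual Y) (dual X \ox A))) -?mcompA.
rewrite rw_lw (comp2 (twist_tensE _ _ _)) -?mcompA.
rewrite (comp3 (yang_baxter Y X (dual Y) (dual X \ox A))) -?mcompA.
rewrite (comp3 (lw32 (yang_baxter Y X (dual X) A))) !lwM -?mcompA.
rewrite (comp3 (lw3 (br_evF _ _ _))) -?mcompA.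
do 2!rewrite (comp2 (evF_nat _ _)) -?mcompA.
rewrite (comp3 (yang_baxter X Y (dual Y) (dual X \ox A))) -?mcompA.
rewrite (comp3 (br_evF X Y _)) -?mcompA !cloE /= !lwM -?mcompA.
do 3!rewrite (comp2 (esym (rw_lw _ _))) -?mcompA.
by [].
Qed.

End DualPairs.

(** * Quantum traces and loops around a strand *)

Section Traces.
Variables (R : realType) (C : ribbonCategory R).
Implicit Types P Q X Y Z V W A B : C.

(* f is closed into a loop. The result is an endomorphism of every object A,
   namely the quantum trace of f times the identity. *)
Definition trD P P' (dP : dual_pair P P') (f : hom P P) A : hom A A :=
  locked (dpc dP A >> rw f (P' \ox A) >> clo dP A).

Lemma trDE P P' (dP : dual_pair P P') f A :
  trD dP f A = dpc dP A >> rw f (P' \ox A) >> clo dP A.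
Proof. by rewrite /trD -lock. Qed.

(** p slides around the loop, passing the dual strand as its transpose. With p an identity, this
    shows that the trace does not depend on the chosen dual. *)
Lemma trD_cyc P P' Q Q' (dP : dual_pair P P') (dQ : dual_pair Q Q')
    (p : hom P Q) (q : hom Q P) A :
  trD dP (p >> q) A = trD dQ (q >> p) A.
Proof.
rewrite !trDE !rwM -?mcompA (dpc_mate dP dQ) (comp2 (esym (rw_lw _ _)))
  -?mcompA.
by rewrite (comp2 (clo_mate _ _ _ _)) -?mcompA.
Qed.

Lemma trD_qtrace X (f : hom X X) A :
  trD (dual_std X) f A = luniti A >> rw (qtrace f) A >> lunit A.
Proof.
rewrite trDE cloE /= coevFE /qtrace !rwM -?mcompA.
rewrite (comp2 (esym (assoc_nat1 _ _ f))) -?mcompA.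
rewrite (comp2 (esym (assoc_nat1 _ _ (twist X)))) -?mcompA.
by rewrite (comp2 (brE _ _ _)) -?mcompA (comp2 (evFE _ _)) -?mcompA.
Qed.

Lemma trD_sum P P' (dP : dual_pair P P') n (f : 'I_n -> hom P P) A :
  trD dP (\sum_k f k) A = \sum_k trD dP (f k) A.
Proof.
rewrite trDE (big_morph _ (fun f g => rwDl _ f g) (rw0 _ _ _)).
rewrite mcomp_suml mcomp_sumr.
by apply: eq_bigr => k _; rewrite trDE.
Qed.

Lemma trDZ P P' (dP : dual_pair P P') a (f : hom P P) A :
  trD dP (a *: f) A = a *: trD dP f A.
Proof. by rewrite !trDE rwZ mcompZl mcompZr. Qed.

(* The loop closing f is linked with a strand labelled V. *)
Definition ptr V P P' (dP : dual_pair P P') (f : hom P P) A :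
    hom (V \ox A) (V \ox A) :=
  locked (lw V (dpc dP A) >> lw V (rw f (P' \ox A)) >> br V P (P' \ox A)
    >> br P V (P' \ox A) >> lw V (clo dP A)).

Lemma ptrE V P P' (dP : dual_pair P P') (f : hom P P) A :
  ptr V dP f A = lw V (dpc dP A) >> lw V (rw f (P' \ox A))
    >> br V P (P' \ox A) >> br P V (P' \ox A) >> lw V (clo dP A).
Proof. by rewrite /ptr -lock. Qed.

Lemma ptr_sum V P P' (dP : dual_pair P P') n (f : 'I_n -> hom P P) A :
  ptr V dP (\sum_k f k) A = \sum_k ptr V dP (f k) A.
Proof.
rewrite ptrE (big_morph _ (fun f g => rwDl _ f g) (rw0 _ _ _)).
rewrite (big_morph _ (fun f g => lwDr _ f g) (lw0 _ _ _)).
rewrite mcomp_suml !mcomp_sumr.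
by apply: eq_bigr => k _; rewrite ptrE.
Qed.

Lemma ptr_cyc V P P' Q Q' (dP : dual_pair P P') (dQ : dual_pair Q Q')
    (p : hom P Q) (q : hom Q P) A :
  ptr V dP (p >> q) A = ptr V dQ (q >> p) A.
Proof.
rewrite !ptrE !rwM !lwM -?mcompA (lw22 (dpc_mate dP dQ p A)).
rewrite (comp2 (lw22 (esym (rw_lw q _)))) -?mcompA.
rewrite (comp2 (br_nat V P _)) -?mcompA (comp2 (br_nat P V _)) -?mcompA.
rewrite (comp2 (lw22 (clo_mate _ _ _ _))) -?mcompA.
rewrite (comp2 (esym (br_natl _ _ _))) -?mcompA.
by rewrite (comp2 (esym (br_natr _ _ _))) -?mcompA.
Qed.

Lemma ptr_nat V P P' (dP : dual_pair P P') (f : hom P P) A B (g : hom A B) :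
  lw V g >> ptr V dP f B = ptr V dP f A >> lw V g.
Proof.
rewrite !ptrE -?mcompA (lw22 (dpc_nat dP g)).
rewrite (comp2 (lw22 (esym (rw_lw f _)))) -?mcompA.
rewrite (comp2 (br_nat V P _)) -?mcompA (comp2 (br_nat P V _)) -?mcompA.
by rewrite (comp2 (lw22 (clo_nat _ _))) -?mcompA.
Qed.

Lemma ptr_mod V P P' (dP : dual_pair P P') (f : hom P P) A B :
  rw (ptr V dP f A) B >> assoc V A B = assoc V A B >> ptr V dP f (A \ox B).
Proof.
rewrite !ptrE !rwM -?mcompA (comp2 (assoc_nat2 _ _ _)) -?mcompA.
rewrite clo_mod !lwM -?mcompA (comp3 (br_mod _ _ _ _)) -?mcompA.
rewrite (comp2 (esym (br_nat P V (assoc P' A B)))) -?mcompA.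
rewrite (comp3 (br_mod _ _ _ _)) -?mcompA.
rewrite (comp2 (esym (br_nat V P (assoc P' A B)))) -?mcompA.
rewrite (comp2 (assoc_nat2 _ _ _)) -?mcompA (comp2 (lw22 (assoc_nat1 _ _ _))).
rewrite -?mcompA (comp2 (lw22 (rw_lw _ _))) -?mcompA assoc_nat2.
by rewrite (comp3 (lw3 (dpc_mod dP _ _))) -?mcompA.
Qed.

(** This makes Schur's lemma applicable to a loop around a simple strand. *)
Lemma ptr_rw V P P' (dP : dual_pair P P') (f : hom P P) :
  exists phi : hom V V, forall A, ptr V dP f A = rw phi A.
Proof.
by eexists; apply: family_rw; [exact: ptr_nat | exact: ptr_mod].
Qed.

(** The trace of the double braiding is the Hopf link, seen here as a loop labelled P around a
    closed strand labelled V. The hypothesis is the conclusion of [clo_tens]. *)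
Lemma trD_braid V P P' V' (dV : dual_pair V V') (dP : dual_pair P P') A :
    (forall B, clo (dual_tens dV dP) B =
       lw (V \ox P) (assoc P' V' B) >> assoc V P _
         >> lw V (clo dP (V' \ox B)) >> clo dV B) ->
  trD (dual_tens dV dP) (braid V P >> braid P V) A =
  dpc dV A >> ptr V dP (idm P) (V' \ox A) >> clo dV A.
Proof.
move=> cloT; rewrite trDE cloT rwM -?mcompA.
do 2!rewrite (comp2 (rw_lw _ _)) -?mcompA.
do 2!rewrite (comp2 (esym (brE _ _ _))) -?mcompA.
by rewrite dpc_tensE ptrE !tensm_id !mcomp_idl -?mcompA.
Qed.

(** A loop labelled by a tensor product is a pair of nested loops; the inner one, labelled Y, is
    replaced by its scalar. *)
Lemma ptr_tens V X X' Y Y' (dX : dual_pair X X') (dY : dual_pair Y Y') s A :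
    (forall B, clo (dual_tens dX dY) B =
       lw (X \ox Y) (assoc Y' X' B) >> assoc X Y _
         >> lw X (clo dY (X' \ox B)) >> clo dX B) ->
    (forall B, ptr V dY (idm Y) B = s *: idm (V \ox B)) ->
  ptr V (dual_tens dX dY) (idm _) A = s *: ptr V dX (idm X) A.
Proof.
move=> cloT sY.
rewrite !ptrE cloT !tensm_id !mcomp_idl !lwM -?mcompA.
rewrite (comp2 (esym (br_nat _ V _))) -?mcompA.
rewrite (comp2 (esym (br_nat V _ _))) -?mcompA.
rewrite (comp2 (br_tensl _ _ _ _)) -?mcompA (comp2 (br_tensr _ _ _ _)) -?mcompA.
rewrite (lw32 (dpc_tensE dX dY A)) -?mcompA.
rewrite (comp2 (br_nat V X _)) -?mcompA.
rewrite (comp2 (esym (br_nat X V _))) -?mcompA.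
have := sY (X' \ox A);
  rewrite ptrE !tensm_id !mcomp_idl => /(congr1 (fun f => lw X f)).
rewrite !lwM -?mcompA => E; rewrite (comp4 E).
by rewrite lwZ tensm_id mcompZl mcomp_idl !mcompZr.
Qed.

Section SimpleUnit.
Hypothesis unit_scalarE : forall g : hom (unit_obj C) (unit_obj C),
  g = unit_scalar g *: idm _.
Hypothesis unit_neq0 : idm (unit_obj C) != 0.

Definition tau X (f : hom X X) : R[i] := unit_scalar (qtrace f).

Lemma trD_tau X (f : hom X X) A : trD (dual_std X) f A = tau f *: idm A.
Proof.
rewrite trD_qtrace [qtrace f]unit_scalarE rwZ tensm_id mcompZl mcomp_idl.
by rewrite mcompZr lunitiK.
Qed.

Lemma tau_unique X (f : hom X X) a :
  trD (dual_std X) f (unit_obj C) = a *: idm _ -> tau f = a.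
Proof.
rewrite trD_tau => /eqP; rewrite -subr_eq0 -scalerBl scaler_eq0.
by rewrite (negbTE unit_neq0) orbF subr_eq0 => /eqP.
Qed.

Lemma tau_cyc X Y (p : hom X Y) (q : hom Y X) : tau (p >> q) = tau (q >> p).
Proof. by apply: tau_unique; rewrite (trD_cyc _ (dual_std Y)) trD_tau. Qed.

Lemma tau_sum X n (f : 'I_n -> hom X X) : tau (\sum_k f k) = \sum_k tau (f k).
Proof.
apply: tau_unique; rewrite trD_sum scaler_suml.
by apply: eq_bigr => k _; rewrite trD_tau.
Qed.

Lemma tauZ X a (f : hom X X) : tau (a *: f) = a * tau f.
Proof. by apply: tau_unique; rewrite trDZ trD_tau scalerA. Qed.

Lemma tau_braid V X s :
    (forall A, ptr V (dual_std X) (idm X) A = s *: idm (V \ox A)) ->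
  tau (braid V X >> braid X V) = s * tau (idm V).
Proof.
move=> sX; apply: tau_unique.
(* The inserted identity lets cyclicity exchange the given dual of the tensor product for the tensor
   product of the duals. *)
rewrite -[_ >> _]mcomp_idl (trD_cyc _ (dual_tens (dual_std V) (dual_std X))).
rewrite mcomp_idr trD_braid; last exact: clo_tens.
rewrite sX mcompZl mcomp_idl mcompZr -scalerA; congr (_ *: _).
by rewrite -trD_tau trDE tensm_id mcomp_idl.
Qed.

Lemma tau_braid_iso X X' Y (f : hom X X') (g : hom X' X) :
    f >> g = idm X -> g >> f = idm X' ->
  tau (braid X Y >> braid Y X) = tau (braid X' Y >> braid Y X').
Proof.
move=> fg gf; rewrite -[braid Y X]mcomp_idl -(tensm_id X Y) -{1}fg rwM -?mcompA.
rewrite tau_cyc -?mcompA braid_natural (comp2 (braid_natural _ _)) -?mcompA.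
by rewrite (comp2 (rw2 gf)) tensm_id mcomp_idl.
Qed.

End SimpleUnit.

End Traces.

(** * Semisimplicity *)

Section LinearAlgebra.
Variable K : fieldType.

(** [i] and [p] are bare functions, since in the applications they are compositions with fixed
    morphisms. *)
Lemma dim_linear_sum (U : vectType K) n (W : 'I_n -> vectType K)
    (i : forall k, W k -> U) (p : forall k, U -> W k) :
    (forall k, linear (i k)) -> (forall k, linear (p k)) ->
    (forall k w, p k (i k w) = w) ->
    (forall k l w, k != l -> p k (i l w) = 0) ->
    (forall u, \sum_k i k (p k u) = u) ->
  \dim {: U} = (\sum_k \dim {: W k})%N.
Proof.
move=> li lp pi pi0 ip.
pose I k : {linear W k -> U} :=
  HB.pack (i k) (GRing.isLinear.Build K (W k) U _ (i k) (li k)).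
pose P k : {linear U -> W k} :=
  HB.pack (p k) (GRing.isLinear.Build K U (W k) _ (p k) (lp k)).
have IE k w : linfun (I k) w = i k w by rewrite lfunE.
have kerI k : (fullv :&: lker (linfun (I k)) = 0)%VS.
  rewrite capfv; apply/eqP/lker0P => u v; rewrite !IE => /(congr1 (p k)).
  by rewrite !pi.
rewrite (eq_bigr (fun k => \dim (limg (linfun (I k)))));
  last by move=> k _; rewrite limg_dim_eq.
have -> : fullv = (\sum_k limg (linfun (I k)))%VS.
  apply/eqP; rewrite eqEsubv subvf andbT; apply/subvP => u _; rewrite -(ip u).
  by apply: memv_sumr => k _; rewrite -IE memv_img ?memvf.
apply/eqP; rewrite -[_ == _]/(directv (\sum_k limg (linfun (I k)))).
apply/directv_sum_independent => us us_in us0 k _.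
have /memv_imgP[w _ ukE] := us_in k isT; rewrite ukE IE.
suff -> : w = 0 by rewrite -[i k 0]/(I k 0) linear0.
have := congr1 (P k) us0; rewrite linear0 linear_sum (bigD1 k) //= big1.
  by rewrite addr0 ukE IE pi.
move=> l lk; have /memv_imgP[v _ ->] := us_in l isT.
by rewrite IE pi0 // eq_sym.
Qed.

Lemma dim_linear_bij (U W : vectType K) (f : U -> W) (g : W -> U) :
    linear f -> linear g -> cancel f g -> cancel g f ->
  \dim {: U} = \dim {: W}.
Proof.
move=> lf lg fK gK.
rewrite (@dim_linear_sum U 1 (fun=> W) (fun=> g) (fun=> f)) ?big_ord1 //.
- by move=> k l; rewrite !ord1.
- by move=> u; rewrite big_ord1.
Qed.

End LinearAlgebra.

Lemma linear_eigenvector (K : numClosedFieldType) (U : vectType K)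
    (f : U -> U) (u0 : U) :
  linear f -> u0 != 0 -> exists a u, u != 0 /\ f u = a *: u.
Proof.
move=> lf u0N.
pose F : {linear U -> U} := HB.pack f (GRing.isLinear.Build K U U _ f lf).
pose A := lin1_mx (v2r \o F \o r2v).
have dim_gt0 : (0 < dim U)%N.
  have : (0 < \dim <[u0]>)%N by rewrite dim_vline u0N.
  by move=> h; apply: leq_trans h _; rewrite -dimvf dimvS ?subvf.
have [a /eigenvalueP[v vA vN]] := eigenvalue_closed A dim_gt0.
exists a, (r2v v); split.
  by apply: contra_neq vN => /(congr1 v2r); rewrite r2vK linear0.
apply: v2r_inj; rewrite linearZ /= r2vK -vA mul_rV_lin1 /=.
by [].
Qed.

(** * Schur's lemma and multiplicities of simple objects *)

Section Semisimple.
Variables (R : realType) (C : linearCategory R).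
Hypotheses (C_abelian : abelian_category C) (C_ss : semisimple_category C).
Implicit Types X Y Z V W : C.

Lemma postcomp_linear X Y Z (f : hom Y Z) : linear (fun g : hom X Y => g >> f).
Proof. by move=> a g h; rewrite mcompDr mcompZr. Qed.

Lemma precomp_linear X Y Z (f : hom X Y) : linear (fun g : hom Y Z => f >> g).
Proof. by move=> a g h; rewrite mcompDl mcompZl. Qed.

Lemma idm_neq0 V : simple_object V -> idm V != 0.
Proof. by case=> V0 _; apply/eqP. Qed.

Lemma schur_iso V W (f : hom V W) :
  simple_object V -> simple_object W -> f != 0 -> is_iso f.
Proof.
move=> [_ sV] [_ sW] /eqP f0; have [_ ker _ _ _] := C_abelian.
have [K [k [fk k_univ]]] := ker _ _ f.
have k_mono : is_mono k.
  move=> Z u v kuv; have [|w [_ w_uniq]] := k_univ _ (u >> k).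
    by rewrite mcompA fk mcomp0l.
  by rewrite -(w_uniq u) // -(w_uniq v).
have [K0|[g [_ gk]]] := sV _ k k_mono; last first.
  by case: f0; rewrite -[f]mcomp_idr -gk mcompA fk mcomp0l.
have f_mono : is_mono f.
  move=> Z u v /eqP; rewrite -subr_eq0 => uv.
  have [|w [wk _]] := k_univ _ (u - v).
    by rewrite mcompDr -scaleN1r mcompZr scaleN1r; apply/eqP.
  by apply/subr0_eq; rewrite -wk -[w]mcomp_idl K0 mcomp0l mcomp0r.
by have [V0|] := sW _ f f_mono; first by case: f0;
  rewrite -[f]mcomp_idr V0 mcomp0r.
Qed.

(** Postcomposition with f has an eigenvalue a, the hom space being finite-dimensional over an
    algebraically closed field; f minus a times the identity is then not invertible, hence zero. *)
Lemma schur_scalar V (f : hom V V) :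
  simple_object V -> exists a, f = a *: idm V.
Proof.
move=> sV; have idN := idm_neq0 sV.
have [a [u [uN fu]]] := linear_eigenvector (@postcomp_linear V V V f) idN.
exists a; apply/eqP; rewrite -subr_eq0; apply/eqP.
apply: contraNeq uN => faN; have [g [fg gf]] := schur_iso sV sV faN.
rewrite -[u]mcomp_idl -fg -mcompA mcompDl -scaleN1r !mcompZl mcomp_idl fu.
by rewrite scaleN1r subrr mcomp0r.
Qed.

Variables (r : nat) (V : 'I_r -> C).
Hypothesis V_simples : lists_simples V.

Lemma dim_hom_simples i j : \dim {: hom (V i) (V j)} = (i == j).
Proof.
have [sV V_inj _] := V_simples.
have [-> | ij] := eqVneq i j; last first.
  suff -> : fullv = 0%VS :> {vspace hom (V i) (V j)} by rewrite dimv0.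
  apply/eqP; rewrite -subv0; apply/subvP => f _; rewrite memv0.
  by apply: contraNT ij => fN; apply/eqP/V_inj; exists f; apply: schur_iso.
suff -> : fullv = <[idm (V j)]>%VS by rewrite dim_vline idm_neq0.
apply/eqP; rewrite eqEsubv subvf andbT; apply/subvP => f _.
by have [a ->] := schur_scalar f (sV j); rewrite memvZ ?memv_line.
Qed.

Lemma simple_summands X :
  exists n (l : 'I_n -> 'I_r), is_direct_sum (fun k => V (l k)) X.
Proof.
have [sV _ V_all] := V_simples;
  have [n [W [sW [inj [prj [ip ip0 sip]]]]]] := C_ss X.
have /choice[l Wl] := fun k => V_all _ (sW k).
pose f k := sval (cid (Wl k)); have fP k : is_iso (f k) := svalP (cid (Wl k)).
pose g k := sval (cid (fP k)).
have gP k : f k >> g k = idm _ /\ g k >> f k = idm _ := svalP (cid (fP k)).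
exists n, l, (fun k => g k >> inj k), (fun k => prj k >> f k); split.
- move=> k; have [_ gf] := gP k.
  by rewrite -?mcompA (comp2 (ip k)) mcomp_idl gf.
- by move=> k j kj; rewrite -?mcompA (comp2 (ip0 _ _ kj)) mcomp0l mcomp0r.
rewrite -sip; apply: eq_bigr => k _; have [fg _] := gP k.
by rewrite -?mcompA (comp2 fg) mcomp_idl.
Qed.

Lemma dim_hom_summandsl X n (l : 'I_n -> 'I_r) b :
  is_direct_sum (fun k => V (l k)) X ->
  \dim {: hom X (V b)} = (\sum_k (l k == b))%N.
Proof.
move=> [inj [prj [ip ip0 sip]]].
under eq_bigr => k _ do rewrite -dim_hom_simples.
apply: (dim_linear_sum (i := fun k g => prj k >> g) (p := fun k g => inj k >>
  g)).
- by move=> k; apply: precomp_linear.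
- by move=> k; apply: precomp_linear.
- by move=> k w; rewrite -mcompA ip mcomp_idr.
- move=> k j w kj; rewrite -mcompA ip0 ?mcomp0r // eq_sym //.
- by move=> u; under eq_bigr => k _ do rewrite -mcompA;
  rewrite -mcomp_sumr sip mcomp_idr.
Qed.

Lemma dim_hom_summandsr X n (l : 'I_n -> 'I_r) b :
  is_direct_sum (fun k => V (l k)) X ->
  \dim {: hom (V b) X} = (\sum_k (l k == b))%N.
Proof.
move=> [inj [prj [ip ip0 sip]]].
under eq_bigr => k _ do rewrite eq_sym -dim_hom_simples.
apply: (dim_linear_sum (i := fun k g => g >> inj k) (p := fun k g => g >> prj
  k)).
- by move=> k; apply: postcomp_linear.
- by move=> k; apply: postcomp_linear.
- by move=> k w; rewrite mcompA ip mcomp_idl.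
- by move=> k j w kj; rewrite mcompA ip0 ?mcomp0l.
- by move=> u; under eq_bigr => k _ do rewrite mcompA;
  rewrite -mcomp_suml sip mcomp_idl.
Qed.

Lemma dim_hom_sym X b : \dim {: hom X (V b)} = \dim {: hom (V b) X}.
Proof.
have [n [l lX]] := simple_summands X.
by rewrite (dim_hom_summandsl _ lX) (dim_hom_summandsr _ lX).
Qed.

(* Additive invariants of objects are determined by their values on simples. *)
Lemma sum_summands X n (l : 'I_n -> 'I_r) (g : 'I_r -> R[i]) :
  is_direct_sum (fun k => V (l k)) X ->
  \sum_k g (l k) = \sum_b (\dim {: hom X (V b)})%:R * g b.
Proof.
move=> lX; under [RHS]eq_bigr => b _ do
  rewrite (dim_hom_summandsl _ lX) natr_sum mulr_suml.
rewrite exchange_big /=; apply: eq_bigr => k _.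
rewrite (bigD1 (l k)) //= eqxx mul1r big1 ?addr0 // => b bk.
by rewrite eq_sym (negbTE bk) mul0r.
Qed.

End Semisimple.

(** * Modular data *)

Section ModularData.
Variables (R : realType) (C : modularCategory R) (n : nat) (V : 'I_n.+1 -> C).
Hypotheses (V_lab : labelling V) (V_sd : self_dual V).

Let C_abelian : abelian_category C. Proof. by case: (modular_fusion C). Qed.
Let C_ss : semisimple_category C. Proof. by case: (modular_fusion C). Qed.
Let unit_simple : simple_object (unit_obj C).
Proof. by case: (modular_fusion C). Qed.
Let V_simples : lists_simples V. Proof. by case: V_lab. Qed.
Let sV i : simple_object (V i). Proof. by case: V_simples. Qed.
Let unitN : idm (unit_obj C) != 0 := idm_neq0 unit_simple.

Let unit_scalarE (g : hom (unit_obj C) (unit_obj C)) : g = unit_scalar g *: idm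
  _.
Proof.
have [a ->] := schur_scalar C_abelian g unit_simple; congr (_ *: _).
rewrite /unit_scalar linearZ /=.
have := @coord_free _ _ 1 [tuple idm (unit_obj C)] ord0 ord0.
by rewrite /= seq1_free => -> //; rewrite mulr1.
Qed.

Local Notation N := (fusion_mult V).

Lemma fusion_multC i j k : N i j k = N j i k.
Proof.
apply: (dim_linear_bij (f := fun g => braidi (V i) (V j) >> g)
  (g := fun g => braid (V i) (V j) >> g)) => [||g|g]; try exact: precomp_linear.
  by rewrite -mcompA braidK mcomp_idr.
by rewrite -mcompA braidiK mcomp_idr.
Qed.

(** Self-duality replaces V i by its dual, Frobenius reciprocity moves it to the target, and
    semisimplicity exchanges source and target. *)
Lemma fusion_multCA i j k : N i j k = N i k j.
Proof.
rewrite /fusion_mult -[RHS]/(\dim {: hom (V i \ox V k) (V j)}).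
rewrite [RHS](dim_hom_sym C_abelian C_ss V_simples).
have [f [g [fg gf]]] := V_sd i.
transitivity (\dim {: hom (dual (V i) \ox V j) (V k)}).
  apply: (dim_linear_bij (f := fun h => rw f (V j) >> h)
    (g := fun h => rw g (V j) >> h)) => [||h|h]; try exact: precomp_linear.
    by rewrite -mcompA -rwM gf tensm_id mcomp_idr.
  by rewrite -mcompA -rwM fg tensm_id mcomp_idr.
apply: (dim_linear_bij (f := fun h => coevF (V i) (V j) >> lw (V i) h)
  (g := fun h => lw (dual (V i)) h >> evF (V i) (V k))) => [a h h'|a h h'|h|h].
- by rewrite lwDr lwZ mcompDl mcompZl.
- by rewrite lwDr lwZ mcompDr mcompZr.
- by rewrite lwM (comp2 (evF_nat _ _)) -?mcompA evF_coevF mcomp_idr.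
- by rewrite lwM -?mcompA -coevF_nat -?mcompA (comp2 (coevF_evF _ _)) mcomp_idl.
Qed.

Lemma fusion_mult0 j k : N ord0 j k = (j == k).
Proof.
rewrite -(dim_hom_simples C_abelian V_simples).
have [f [g [fg gf]]] : isomorphic (V ord0) (unit_obj C) by case: V_lab.
apply: (dim_linear_bij (f := fun h => luniti (V j) >> rw g (V j) >> h)
  (g := fun h => rw f (V j) >> lunit (V j) >> h)) => [||h|h];
  try exact: precomp_linear.
  by rewrite -?mcompA (isoK (lunitK _)) -rwM fg tensm_id mcomp_idr.
rewrite -?mcompA (comp2 (rw2 gf)) tensm_id mcomp_idl.
by rewrite lunitiK mcomp_idr.
Qed.

Let twist_scalar i : exists a, twist (V i) = a *: idm (V i).
Proof. exact: (schur_scalar C_abelian (twist (V i)) (sV i)). Qed.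

Let th i : R[i] := sval (cid (twist_scalar i)).
Let thE i : twist (V i) = th i *: idm (V i).
Proof. exact: svalP (cid (twist_scalar i)). Qed.

Let th_neq0 i : th i != 0.
Proof.
apply: contra_neq (idm_neq0 (sV i)) => th0.
have [g [_ gE]] := twist_iso (V i).
by rewrite -gE thE th0 scale0r mcomp0l.
Qed.

Let loop_scalar j X : exists s, forall A,
  ptr (V j) (dual_std X) (idm X) A = s *: idm (V j \ox A).
Proof.
have [phi phiE] := ptr_rw (V j) (dual_std X) (idm X).
have [s sE] := schur_scalar C_abelian phi (sV j).
by exists s => A; rewrite phiE sE rwZ tensm_id.
Qed.

Let loop j X : R[i] := sval (cid (loop_scalar j X)).
Let loopE j X A : ptr (V j) (dual_std X) (idm X) A = loop j X *: idm (V j \ox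
  A).
Proof. by move: A; exact: svalP (cid (loop_scalar j X)). Qed.

Let loop_unique j X a :
  (forall A, ptr (V j) (dual_std X) (idm X) A = a *: idm (V j \ox A)) ->
  loop j X = a.
Proof.
move=> aE; have := aE (unit_obj C); rewrite loopE => /eqP.
rewrite -subr_eq0 -scalerBl scaler_eq0 subr_eq0 => /orP[/eqP // | /eqP id0].
case/eqP: (idm_neq0 (sV j)); rewrite -(runitiK (V j)).
by rewrite -[runiti _]mcomp_idl id0 mcomp0l mcomp0r.
Qed.

Let loop_tens j X Y : loop j (X \ox Y) = loop j X * loop j Y.
Proof.
apply: loop_unique => A; rewrite -[idm _]mcomp_idl.
rewrite (ptr_cyc _ _ (dual_tens (dual_std X) (dual_std Y))) mcomp_idl.
rewrite (@ptr_tens _ _ _ _ _ _ _ _ _ (loop j Y)) ?loopE ?scalerA 1?mulrC //.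
exact: clo_tens.
Qed.

Let loop_sum j X m (l : 'I_m -> 'I_n.+1) :
  is_direct_sum (fun k => V (l k)) X -> loop j X = \sum_k loop j (V (l k)).
Proof.
move=> [inj [prj [ip ip0 sip]]]; apply: loop_unique => A.
rewrite -sip ptr_sum scaler_suml; apply: eq_bigr => k _.
by rewrite (ptr_cyc _ _ (dual_std (V (l k)))) ip loopE.
Qed.

Let loopM i j k :
  loop j (V i) * loop j (V k) = \sum_l (N i k l)%:R * loop j (V l).
Proof.
rewrite -loop_tens; have [m [l lX]] := simple_summands C_ss V_simples (V i \ox
  V k).
by rewrite (loop_sum _ lX) (sum_summands C_abelian V_simples (fun b => loop j
  (V b)) lX).
Qed.

(** Self-duality removes the dual object from the definition of [Smatrix]. *)
Let SmatrixE i j : Smatrix V i j = tau (braid (V i) (V j) >> braid (V j) (V i)).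
Proof.
have [f [g [fg gf]]] := V_sd i.
by rewrite mxE; apply: (tau_braid_iso unit_scalarE unitN);
  [exact: fg|exact: gf].
Qed.

Let Smatrix_loop i j : Smatrix V i j = loop j (V i) * tau (idm (V j)).
Proof.
by rewrite SmatrixE tau_cyc //; apply: tau_braid.
Qed.

Let tau_twist X : 
  tau (twist X) = \sum_k (\dim {: hom X (V k)})%:R * (th k * tau (idm (V k))).
Proof.
have [m [l lX]] := simple_summands C_ss V_simples X.
rewrite -(sum_summands C_abelian V_simples (fun k => th k * tau (idm (V k)))
  lX).
have [inj [prj [ip ip0 sip]]] := lX.
rewrite -[twist X]mcomp_idr -sip mcomp_sumr tau_sum //.
apply: eq_bigr => k _; rewrite mcompA twist_natural tau_cyc // mcompA ip.
by rewrite mcomp_idl thE tauZ.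
Qed.

(** The trace of the twist of V i (x) V j, computed by [twist_tens] on the left and on the simple
    summands on the right. *)
Let balancing i j :
  th i * th j * Smatrix V i j = \sum_k (N i j k)%:R * (th k * tau (idm (V k))).
Proof.
rewrite -[RHS]tau_twist SmatrixE twist_tens !thE.
have -> : tensm (th i *: idm (V i)) (th j *: idm (V j)) = (th i * th j) *: idm
  _.
  have -> : tensm (th i *: idm (V i)) (th j *: idm (V j)) =
    rw (th i *: idm (V i)) (V j) >> lw (V i) (th j *: idm (V j)).
    by rewrite -tensm_comp mcomp_idl mcomp_idr.
  by rewrite rwZ lwZ !tensm_id mcompZl mcomp_idl scalerA mulrC.
by rewrite mcompZr mcomp_idr tauZ.
Qed.

(* th are the twists, d the dimensions, and s i j is the scalar by which a loop
   labelled i around a strand labelled j acts. *)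
Lemma modular_data : exists (s : 'I_n.+1 -> 'I_n.+1 -> R[i]) (d th : 'I_n.+1 ->
  R[i]),
  [/\ forall i j k, s i j * s k j = \sum_l (N i k l)%:R * s l j,
      forall i j, Smatrix V i j = s i j * d j,
      forall i j, th i * th j * Smatrix V i j =
        \sum_k (N i j k)%:R * (th k * d k)
    & forall i, th i != 0].
Proof.
by exists (fun i j => loop j (V i)), (fun i => tau (idm (V i))), th; split.
Qed.

End ModularData.

(** * Orthogonality, Gauss sums and the modular relations *)

Section ModularRelations.
Variables (F : fieldType) (n : nat) (N : 'I_n.+1 -> 'I_n.+1 -> 'I_n.+1 -> nat).
Variables (S : 'M[F]_n.+1) (s : 'I_n.+1 -> 'I_n.+1 -> F) (d th : 'I_n.+1 -> F).
Hypotheses (NC : forall i j k, N i j k = N j i k)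
  (NCA : forall i j k, N i j k = N i k j)
  (N0 : forall j k, N ord0 j k = (j == k)).
Hypothesis s_mul :
  forall i j k, s i j * s k j = \sum_l (N i k l)%:R * s l j.
Hypothesis SE : forall i j, S i j = s i j * d j.
Hypothesis balance :
  forall i j, th i * th j * S i j = \sum_k (N i j k)%:R * (th k * d k).
Hypotheses (th_neq0 : forall i, th i != 0) (S_unit : S \in unitmx).

Let S_inj (x : 'I_n.+1 -> F) : (forall k, \sum_l S k l * x l = 0) -> forall l,
  x l = 0.
Proof.
move=> Sx l; have /colP/(_ l) : \col_l x l = 0 :> 'cV_n.+1;
  last by rewrite !mxE.
rewrite -[LHS](mulKmx S_unit); apply/matrixP => i j;
  rewrite !mxE big1 // => k _.
by rewrite !mxE; under eq_bigr do rewrite mxE; rewrite Sx mulr0.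
Qed.

Let sum_delta (f : 'I_n.+1 -> F) j : \sum_k (j == k)%:R * f k = f j.
Proof.
rewrite (bigD1 j) //= eqxx mul1r big1 ?addr0 // => k kj.
by rewrite eq_sym (negbTE kj) mul0r.
Qed.

Let S_sym i j : S i j = S j i.
Proof.
apply: (mulfI (mulf_neq0 (th_neq0 i) (th_neq0 j))).
by rewrite balance mulrC [th i * _]mulrC [in RHS]mulrC balance;
  under eq_bigr do rewrite NC.
Qed.

Let col_neq0 j : ~ (forall i, S i j = 0).
Proof.
move=> Sj; have := S_inj (x := fun k => (j == k)%:R) _ j; rewrite eqxx => H.
suff /eqP : 1 = 0 :> F by rewrite oner_eq0.
by apply: H => k; under eq_bigr do rewrite mulrC; rewrite sum_delta.
Qed.

Let d_neq0 j : d j != 0.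
Proof. by apply/eqP => dj; apply: (@col_neq0 j) => i; rewrite SE dj mulr0. Qed.

(** Label 0 is the unit of the fusion ring; a character vanishing there is zero, which would give S
    a zero column. *)
Let s0 j : s ord0 j = 1.
Proof.
have s0M i : s ord0 j * s i j = s i j.
  by rewrite s_mul; under eq_bigr do rewrite N0; rewrite sum_delta.
have [s0j|s0j] := eqVneq (s ord0 j) 0; last by apply: (mulfI s0j);
  rewrite s0M mulr1.
case: (@col_neq0 j) => i.
by rewrite SE -s0M s0j !mul0r.
Qed.

Let S0 j : S ord0 j = d j. Proof. by rewrite SE s0 mul1r. Qed.

Let th0 : th ord0 = 1.
Proof.
apply: (mulIf (mulf_neq0 (th_neq0 ord0) (d_neq0 ord0))).
rewrite mul1r mulrA -[in LHS]S0 balance; under eq_bigr do rewrite N0.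
by rewrite sum_delta.
Qed.

(** Distinct characters of the fusion ring are orthogonal: by [NCA], multiplication by label k is
    symmetric, so c is multiplied equally by both characters. No conjugate occurs because of
    self-duality. *)
Let s_orth i j : i != j -> \sum_k s k i * s k j = 0.
Proof.
set c := \sum_k _ => ij.
have cE k : s k i * c = s k j * c.
  transitivity (\sum_l (s k i * s l i) * s l j).
    by rewrite mulr_sumr; apply: eq_bigr => l _; rewrite mulrA.
  transitivity (\sum_l s l i * (s k j * s l j)).
    under eq_bigr do rewrite s_mul mulr_suml.
    rewrite exchange_big /=; apply: eq_bigr => l _; rewrite s_mul mulr_sumr.
    by apply: eq_bigr => m _; rewrite NCA mulrCA mulrA.
  by rewrite mulr_sumr; apply: eq_bigr => l _; rewrite mulrCA.
apply/eqP; apply: contraTT isT => c0.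
have ss k : s k i = s k j by apply: (mulIf c0).
(* Equal characters make columns i and j of S proportional to d_i and d_j, so this vector lies in
   the kernel of S. *)
have := S_inj (x := fun l => (i == l)%:R * d j - (j == l)%:R * d i) _ i.
rewrite eqxx eq_sym (negbTE ij) mul1r mul0r subr0 => H.
have /eqP := d_neq0 j; case; apply: H => k.
under eq_bigr do rewrite mulrBr !(mulrCA (S _ _)).
by rewrite sumrB !sum_delta !SE ss mulrAC subrr.
Qed.

Let mu := \sum_k S ord0 k * S k ord0.

(** Off the diagonal this is [s_orth]. The diagonal entries agree because the entry (0, i) of S^3
    can be bracketed in two ways. *)
Let SS i j : \sum_k S i k * S k j = (i == j)%:R * mu.
Proof.
have off a b : a != b -> \sum_k S a k * S k b = 0.
  move=> ab; transitivity (d a * d b * \sum_k s k a * s k b); last first.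
    by rewrite s_orth ?mulr0.
  rewrite mulr_sumr.
  by apply: eq_bigr => k _; rewrite S_sym !SE mulrACA mulrC.
have [<-|/off -> //] := eqVneq i j; rewrite ?mul0r // mul1r.
apply: (mulfI (d_neq0 i)); rewrite -S0.
transitivity (\sum_k S ord0 k * (\sum_l S k l * S l i)).
  rewrite [RHS](bigD1 i) //= [X in _ = _ + X]big1 ?addr0 // => k ki.
  by rewrite off // mulr0.
transitivity (\sum_l (\sum_k S ord0 k * S k l) * S l i).
  under eq_bigr do rewrite mulr_sumr.
  rewrite exchange_big; apply: eq_bigr => l _; rewrite mulr_suml.
  by apply: eq_bigr => k _; rewrite mulrA.
rewrite (bigD1 ord0) //= -/mu [X in _ + X]big1 ?addr0 1?mulrC // => k k0.
by rewrite off 1?eq_sym // mul0r.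
Qed.

Let mu_neq0 : mu != 0.
Proof.
apply/eqP => mu0; case: (@col_neq0 ord0); apply: S_inj => k.
by rewrite SS mu0 mulr0.
Qed.

Let sj0 j : s j ord0 = d j / d ord0.
Proof. by rewrite -[d j]S0 S_sym SE mulfK. Qed.

(** The Gauss sum, divided by d_0 so that it scales like the dimensions: [S ord0 ord0] is not yet
    normalized to 1. *)
Let p := (\sum_k th k * d k ^+ 2) / d ord0.

(** Balancing expands th_k th_m S_km, and the sum over k is evaluated because the dimensions are
    proportional to the character in column 0. *)
Let gauss m : th m * (\sum_k d k * th k * S k m) = p * d m.
Proof.
transitivity (\sum_l (th l * d l) * (\sum_k (N l m k)%:R * d k)).
  transitivity (\sum_k d k * (th k * th m * S k m)).
    by rewrite mulr_sumr; apply: eq_bigr => k _; ring.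
  under eq_bigr do rewrite balance mulr_sumr.
  rewrite exchange_big /=; apply: eq_bigr => l _; rewrite mulr_sumr.
  apply: eq_bigr => k _; rewrite [N k m l]NC NCA NC; ring.
rewrite /p mulrAC mulr_suml mulr_suml; apply: eq_bigr => l _.
have -> : \sum_k (N l m k)%:R * d k = s l ord0 * s m ord0 * d ord0.
  rewrite s_mul mulr_suml; apply: eq_bigr => k _.
  by rewrite sj0 -mulrA divfK.
rewrite !sj0; field.
exact: d_neq0.
Qed.

(** In matrix form, p S T^-1 S = mu T S T. [gauss] rewrites p d_m / th_m, the fusion rules expand
    s_im s_jm, and [SS] collapses the double sum to the balancing equation. *)
Let relation1 i j :
  p * (\sum_k S i k * (th k)^-1 * S k j) = mu * (th i * th j * S i j).
Proof.
transitivity (\sum_m S i m * S j m * (p * (th m)^-1)).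
  rewrite mulr_sumr; apply: eq_bigr => m _; rewrite (S_sym j m); ring.
transitivity (\sum_m (\sum_l (N i j l)%:R * S l m) * (\sum_k d k * th k * S k
  m)).
  apply: eq_bigr => m _.
  have -> : \sum_k d k * th k * S k m = p * d m / th m.
    by rewrite -gauss mulrAC mulfV // mul1r.
  have -> : \sum_l (N i j l)%:R * S l m = s i m * s j m * d m.
    by rewrite s_mul mulr_suml; apply: eq_bigr => l _; rewrite SE mulrA.
  rewrite !SE; ring.
rewrite balance mulr_sumr.
under eq_bigr do rewrite mulr_suml.
rewrite exchange_big /=; apply: eq_bigr => l _.
transitivity ((N i j l)%:R * (\sum_k (d k * th k) * (\sum_m S l m * S m k))).
  rewrite mulr_sumr; under [RHS]eq_bigr do rewrite mulr_sumr mulr_sumr.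
  rewrite exchange_big /=; apply: eq_bigr => m _; rewrite mulr_sumr.
  by apply: eq_bigr => k _; rewrite (S_sym m k); ring.
under eq_bigr do rewrite SS mulrCA.
by rewrite sum_delta; ring.
Qed.

Let p_neq0 : p != 0.
Proof.
apply/eqP => p0; case: (@col_neq0 ord0) => i.
have := relation1 i ord0; rewrite p0 mul0r => /esym/eqP.
by rewrite !mulf_eq0 !(negbTE (th_neq0 _)) (negbTE mu_neq0) /= => /eqP.
Qed.

(** [relation1] is multiplied on the right by S T S S; since S S = mu, both sides acquire the factor
    mu^2, which cancels. *)
Let relation2 i j : th i * th j * (\sum_k S i k * th k * S k j) = p * S i j.
Proof.
pose T := diag_mx (\row_k th k); pose T' := diag_mx (\row_k (th k)^-1).
have TT' : T *m T' = 1%:M.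
  by rewrite mulmx_diag -diag_const_mx; congr diag_mx; apply/rowP => k;
    rewrite !mxE mulfV.
have T'T : T' *m T = 1%:M.
  by rewrite mulmx_diag -diag_const_mx; congr diag_mx; apply/rowP => k;
    rewrite !mxE mulVf.
have STE (x : 'I_n.+1 -> F) a b :
    (S *m diag_mx (\row_k x k) *m S) a b = \sum_k S a k * x k * S k b.
  rewrite mxE; apply: eq_bigr => k _; rewrite mul_mx_diag !mxE //.
have TXE (x : 'I_n.+1 -> F) (M : 'M_n.+1) a b :
    (diag_mx (\row_k x k) *m M *m diag_mx (\row_k x k)) a b = x a * x b * M a b.
  by rewrite mul_mx_diag mxE mul_diag_mx !mxE; ring.
have SSm : S *m S = mu%:M.
  by apply/matrixP => a b; rewrite !mxE SS mulr_natl.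
have r1 : p *: (S *m T' *m S) = mu *: (T *m S *m T).
  by apply/matrixP => a b; rewrite mxE [RHS]mxE /T /T' STE TXE relation1.
have XSS (M : 'M_n.+1) : M *m S *m S = mu *: M.
  by rewrite -mulmxA SSm mul_mx_scalar.
have r2 : T *m (S *m T *m S) *m T = p *: S.
  apply: (scalerI (mulf_neq0 mu_neq0 mu_neq0)).
  have := congr1 (fun M => M *m (S *m T *m S) *m S) r1.
  rewrite /= -!scalemxAl !mulmxA !XSS -?scalemxAl -[S *m T' *m T]mulmxA T'T
    mulmx1.
  by rewrite !scalerA => <-; congr (_ *: _); ring.
by have /matrixP/(_ i j) := r2; rewrite /T TXE STE mxE.
Qed.

(* x is the S-matrix, rescaled so that its first entry is 1. The last two
   relations are S T S = p T^-1 S T^-1 and its inverse. *)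
Lemma modular_relations : exists (x : 'I_n.+1 -> 'I_n.+1 -> F) mu p,
  [/\ forall i j, x i j = x j i, x ord0 ord0 = 1, forall j, x ord0 j != 0,
      forall i j, S i j / S ord0 j = x i j / x ord0 j
    & [/\ mu != 0, p != 0,
          forall i j, \sum_k x i k * x k j = (i == j)%:R * mu,
          forall i j, th i * th j * (\sum_k x i k * th k * x k j) = p * x i j
        & forall i j,
          p * (\sum_k x i k * (th k)^-1 * x k j) = mu * (th i * th j * x i j)]]
  /\ th ord0 = 1.
Proof.
have d0 := d_neq0 ord0.
exists (fun i j => S i j / d ord0), (mu / d ord0 ^+ 2), (p / d ord0).
split=> //; split=> [i j|||i j|].
- by rewrite S_sym.
- by rewrite S0 divff.
- by move=> j; rewrite S0 mulf_neq0 ?invr_neq0 ?d_neq0.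
- by rewrite !S0; field; rewrite d0 d_neq0.
have sumE (f : 'I_n.+1 -> F) i j :
    \sum_k S i k / d ord0 * f k * (S k j / d ord0)
      = (\sum_k S i k * f k * S k j) / d ord0 ^+ 2.
  by rewrite mulr_suml; apply: eq_bigr => k _; field.
split=> [|||i j|i j].
- by rewrite mulf_neq0 ?invr_neq0 ?expf_neq0.
- by rewrite mulf_neq0 ?invr_neq0.
- move=> i j; rewrite mulrA -SS mulr_suml; apply: eq_bigr => k _; field.
  exact: d0.
- rewrite sumE mulrA relation2; field; exact: d0.
- rewrite sumE mulrA [p / _ * _]mulrAC relation1; field; exact: d0.
Qed.

End ModularRelations.

(** * The Galois action of a 4-cycle *)

Section SpectralCases.
Variable F : numFieldType.
Implicit Types u v a b c e y p mu t A E Y Z : F.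

(** Certificates: the goal is a combination of known equations with coefficients c1, c2, c3, and the
    last premise is left to [ring] or [field]. *)
Lemma lincomb3 (c1 c2 c3 l1 r1 l2 r2 l3 r3 l r : F) :
    l1 = r1 -> l2 = r2 -> l3 = r3 ->
    l - r = c1 * (l1 - r1) + c2 * (l2 - r2) + c3 * (l3 - r3) ->
  l = r.
Proof.
move=> -> -> -> E; apply/eqP; rewrite -subr_eq0 E !subrr !mulr0 !addr0.
exact: eqxx.
Qed.

Lemma lincomb2 (c1 c2 l1 r1 l2 r2 l r : F) :
  l1 = r1 -> l2 = r2 -> l - r = c1 * (l1 - r1) + c2 * (l2 - r2) -> l = r.
Proof.
by move=> E1 E2 E; apply: (@lincomb3 c1 c2 0 _ _ _ _ 0 0 _ _ E1 E2);
  rewrite // mul0r addr0.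
Qed.

Lemma lincomb1 (c l1 r1 l r : F) : l1 = r1 -> l - r = c * (l1 - r1) -> l = r.
Proof.
by move=> E1 E; apply: (@lincomb2 c 0 _ _ 0 0 _ _ E1); rewrite // mul0r addr0.
Qed.

(* The hypotheses of the next two lemmas are entries of the matrix identities
   satisfied by z of the section FourCycle, with k = 1 and k = -1
   respectively. *)
Lemma equal_sign_case u v a b c e Y Z mu :
    u != 0 -> v != 0 -> b * u = c * v ->
    4 * u * v + b * u * (a * u + e * v) = 0 ->
    Y = - (a * u + b * v) -> Y = - (c * u + e * v) ->
    Z ^+ 2 = mu -> mu = (4 + a ^+ 2 + b ^+ 2) * u ^+ 2 ->
  c != 0 /\ (2 * c * Z) ^+ 2 = ((b ^+ 2 + c ^+ 2 + 4) * u) ^+ 2.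
Proof.
move=> u0 v0 bc uv Y1 Y2 Zmu muE.
have c0 : c != 0.
  apply: contra_neq v0 => c0; move: uv; rewrite bc c0 !mul0r addr0 => /eqP.
  by rewrite !mulf_eq0 pnatr_eq0 (negbTE u0) /= => /eqP.
split=> //.
(* The sum and the difference of a c and b e are found in terms of b and c, which eliminates e and
   determines a c. *)
have R1 : a * c + b * e = - 4.
  apply: (mulfI v0); apply: (mulfI u0).
  have : 4 * u * v + c * v * (a * u) + b * u * e * v = 0.
    by rewrite -[RHS]uv -bc; ring.
  by move=> H; apply/eqP; rewrite -subr_eq0 -[X in _ == X]H; apply/eqP; ring.
have R2 : a * c + b ^+ 2 = c ^+ 2 + b * e.
  apply: (mulfI u0).
  have : a * u + b * v = c * u + e * v by apply: oppr_inj; rewrite -Y1 -Y2.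
  move/(congr1 (fun x => c * x)) => H.
  transitivity (c * (a * u + b * v)).
    by rewrite (_ : c * _ = a * c * u + b * (c * v)); [rewrite -bc|]; ring.
  by rewrite H (_ : c * _ = c ^+ 2 * u + e * (c * v)); [rewrite -bc|]; ring.
have R3 : 2 * (a * c) = c ^+ 2 - b ^+ 2 - 4.
  have -> : 2 * (a * c) = (a * c + b ^+ 2) - b ^+ 2 + (a * c + b * e) - b * e
    by ring.
  by rewrite R1 R2; ring.
rewrite exprMn Zmu muE.
have -> : (2 * c) ^+ 2 * ((4 + a ^+ 2 + b ^+ 2) * u ^+ 2) =
  (4 * c ^+ 2 * (4 + b ^+ 2) + (2 * (a * c)) ^+ 2) * u ^+ 2 by ring.
(* With m = b^2 + 4 this is 4 c^2 m + (c^2 - m)^2 = (c^2 + m)^2. *)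
by rewrite R3; ring.
Qed.

Lemma opposite_sign_case u v y1 y2 y3 A E mu p t1 t2 t3 t4 t5 :
    u != 0 -> v != 0 -> t1 != 0 -> t2 != 0 -> t3 != 0 -> t4 != 0 -> t5 != 0 ->
    mu != 0 ->
    1 + y1 ^+ 2 + y2 ^+ 2 + y3 ^+ 2 + u ^+ 2 + v ^+ 2 = mu ->
    2 * (y2 + y1 * y3) + u ^+ 2 + v ^+ 2 = 0 ->
    4 * u ^+ 2 + A ^+ 2 = mu -> 4 * v ^+ 2 + E ^+ 2 = mu ->
    1 - t1 + t2 - t3 = 0 -> 1 - t1^-1 + t2^-1 - t3^-1 = 0 ->
    t4 * (1 + t1 * y1 + t2 * y2 + t3 * y3 + A * t4) = p ->
    t4 * t1 * (y1 + t1 * y2 + t2 * y3 + t3 + A * t4) = p ->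
    t4 * t2 * (y2 + t1 * y3 + t2 + t3 * y1 + A * t4) = p ->
    t4 * t3 * (y3 + t1 + t2 * y1 + t3 * y2 + A * t4) = p ->
    t5 * (1 - t1 * y1 + t2 * y2 - t3 * y3 + E * t5) = p ->
    t5 * t2 * (y2 - t1 * y3 + t2 - t3 * y1 + E * t5) = p ->
    t2 * (y2 + y1 * t1 * y3 + y2 * t2 + y3 * t3 * y1 + u ^+ 2 * t4 + v ^+ 2 *
      t5)
      = p * y2 ->
    t1 ^+ 2 * (y1 ^+ 2 + y2 ^+ 2 * t1 + y3 ^+ 2 * t2 + t3 + u ^+ 2 * t4
      + v ^+ 2 * t5) = p * y2 ->
  u ^+ 2 = v ^+ 2 \/ y2 = 1.
Proof.
move=> u0 v0 t10 t20 t30 t40 t50 mu0 S00 S02 S44 S55 T45 T45' T40 T41 T42 T43.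
move=> T50 T52 T02 T11.
have two0 : (2 : F) != 0 by rewrite pnatr_eq0.
have four0 : (4 : F) != 0 by rewrite pnatr_eq0.
have t13 : t1 + t3 = 1 + t2 by apply/esym/subr0_eq; rewrite -T45; ring.
(* If t2 = -1, then t3 = -t1, and [T40] and [T42] add up their A terms to 2 t4^2 A = 0; likewise E =
   0, and the norms of rows 4 and 5 give u^2 = v^2. *)
have [h0|h0] := eqVneq (1 + t2) 0.
  left; have t2E : t2 = - 1 by apply/eqP; rewrite -addr_eq0 addrC h0.
  have t3E : t3 = - t1 by apply/eqP; rewrite -addr_eq0 addrC t13 h0.
  have A0 : A = 0.
    apply: (mulfI (mulf_neq0 two0 (mulf_neq0 t40 t40))).
    have : p - p = 0 by rewrite subrr.
    rewrite -{1}T40 -T42 t2E t3E => H; rewrite mulr0 -[RHS]H; ring.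
  have E0 : E = 0.
    apply: (mulfI (mulf_neq0 two0 (mulf_neq0 t50 t50))).
    have : p - p = 0 by rewrite subrr.
    rewrite -{1}T50 -T52 t2E t3E => H; rewrite mulr0 -[RHS]H; ring.
  by apply: (mulfI four0); move: S44 S55; rewrite A0 E0 expr0n !addr0 => -> ->.
(* Now t1 and t3 have sum 1 + t2 and product t2, so one of them is 1 and the other is t2. *)
have t2E : t1 * t3 = t2.
  apply: (mulfI h0).
  have : (t1 + t3) * t2 = (1 + t2) * (t1 * t3).
    have : (1 - t1^-1 + t2^-1 - t3^-1) * (t1 * t2 * t3) = 0 by rewrite T45'
      mul0r.
    have -> : (1 - t1^-1 + t2^-1 - t3^-1) * (t1 * t2 * t3)
       = (1 + t2) * (t1 * t3) - (t1 + t3) * t2 by field; rewrite t30 t20 t10.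
    by move/subr0_eq.
  by move=> <-; rewrite t13.
have : (t1 - 1) * (t3 - 1) = 0.
  have -> : (t1 - 1) * (t3 - 1) = t1 * t3 - (t1 + t3) + 1 by ring.
  by rewrite t2E t13; ring.
(* Its premise, times t4, is the difference of [T40] and [T41] if t1 = 1, and of [T40] and [T43] if
   t3 = 1. *)
have key : (1 - t2) * (1 - y2) = 0 -> y2 = 1 \/ t2 = 1.
  move=> /eqP; rewrite mulf_eq0 !subr_eq0 => /orP[]/eqP H; by [right|left].
(* Here [T11] and [T02] differ by 1 + y1^2 + y2^2 + y3^2 - 2 (y2 + y1 y3), which therefore vanishes;
   adding [S02] gives mu = 0, a contradiction. *)
have main : t1 = 1 -> t2 = 1 -> t3 = 1 -> u ^+ 2 = v ^+ 2 \/ y2 = 1.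
  move=> t1E t2E' t3E; case/eqP: mu0.
  have : p * y2 - p * y2 = 0 by rewrite subrr.
  rewrite -{1}T11 -T02 t1E t2E' t3E => H; rewrite -S00.
  rewrite -[RHS]addr0 -{2}H -S02; ring.
move=> /eqP; rewrite mulf_eq0 !subr_eq0 => /orP[]/eqP tE.
  have t32 : t3 = t2 by rewrite -t2E tE mul1r.
  have [|y2E|t21] := key; [|by right|by apply: main; rewrite // t32].
  apply: (mulfI t40); have : p - p = 0 by rewrite subrr.
  rewrite -{1}T40 -T41 tE t32 => H; rewrite mulr0 -[RHS]H; ring.
have t12 : t1 = t2 by rewrite -t2E tE mulr1.
have [|y2E|t21] := key; [|by right|by apply: main; rewrite // t12].
apply: (mulfI t40); have : p - p = 0 by rewrite subrr.
rewrite -{1}T40 -T43 tE t12 => H; rewrite mulr0 -[RHS]H; ring.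
Qed.

End SpectralCases.
Arguments lincomb3 {F} c1 c2 c3 {l1 r1 l2 r2 l3 r3 l r}.
Arguments lincomb2 {F} c1 c2 {l1 r1 l2 r2 l r}.
Arguments lincomb1 {F} c {l1 r1 l r}.

(** * The shape of the S-matrix under a 4-cycle, and the two sign cases *)

Section FourCycle.
Variables (F : numFieldType) (x : 'I_6 -> 'I_6 -> F) (mu p : F) (th : 'I_6 ->
  F).
Hypotheses (x_sym : forall i j, x i j = x j i) (x00 : x ord0 ord0 = 1)
  (x0_neq0 : forall j, x ord0 j != 0) (mu_neq0 : mu != 0) (p_neq0 : p != 0)
  (th_neq0 : forall i, th i != 0) (th0 : th ord0 = 1).
Hypothesis xx : forall i j, \sum_k x i k * x k j = (i == j)%:R * mu.
Hypothesis xTx :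
  forall i j, th i * th j * (\sum_k x i k * th k * x k j) = p * x i j.
Hypothesis xT'x : forall i j,
  p * (\sum_k x i k * (th k)^-1 * x k j) = mu * (th i * th j * x i j).

Let s i j := x i j / x ord0 j.

Variables (K : {pred F}) (phi : F -> F).
Hypotheses (K_divring : GRing.divring_closed K) (sK : forall i j, s i j \in K).
Hypotheses (phi1 : phi 1 = 1)
  (phiD : forall a b, a \in K -> b \in K -> phi (a + b) = phi a + phi b)
  (phiM : forall a b, a \in K -> b \in K -> phi (a * b) = phi a * phi b)
  (phi_s : forall i j, phi (s i j) = s i (cycle0123 j)).

(** The graph of sigma on K: membership travels with the value, so that images of compound
    expressions are built without side conditions. *)
Let to a b := a \in K /\ phi a = b.

Let to1 : to 1 1. Proof. by split=> //; case: K_divring. Qed.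

Let to0 : to 0 0.
Proof.
have K0 : 0 \in K by case: K_divring => K1 KB _; rewrite -(subrr 1) KB.
by split=> //; apply: (addrI (phi 0)); rewrite -phiD // !addr0.
Qed.

Let toN a b : to a b -> to (- a) (- b).
Proof.
move=> [aK <-]; have [K0 phi0] := to0.
have NaK : - a \in K by case: K_divring => _ KB _; rewrite -sub0r KB.
by split=> //; apply: (addrI (phi a)); rewrite -phiD // !subrr.
Qed.

Let toD a b a' b' : to a b -> to a' b' -> to (a + a') (b + b').
Proof.
move=> ab ab'; have [Na'K _] := toN ab'; case: ab ab' => aK <- [a'K <-].
split; last by rewrite phiD.
by case: K_divring => _ KB _; rewrite -[a']opprK KB.
Qed.

Let toM a b a' b' : to a b -> to a' b' -> to (a * a') (b * b').
Proof.
move=> [aK <-] [a'K <-]; split; last by rewrite phiM.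
case: K_divring => K1 _ Kdiv.
(* K is given as closed under division, so a a' is written as a / (1 / a'); this covers a' = 0 as
   well. *)
by rewrite -[a']invrK -[a'^-1]mul1r Kdiv // Kdiv.
Qed.

Let to_sum n (f g : 'I_n -> F) :
  (forall k, to (f k) (g k)) -> to (\sum_k f k) (\sum_k g k).
Proof.
elim: n f g => [|n IHn] f g fg; first by rewrite !big_ord0.
by rewrite !big_ord_recl; apply: toD => //; apply: IHn.
Qed.

Let to_fun a b b' : to a b -> to a b' -> b = b'.
Proof. by move=> [_ <-] [_ <-]. Qed.

Let to_s i j : to (s i j) (s i (cycle0123 j)). Proof. by []. Qed.

Let cycle_inord k : (k < 6)%N ->
  cycle0123 (inord k) = inord (nth 0%N [:: 1; 2; 3; 0; 4; 5]%N k).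
Proof.
move=> k6; apply/val_inj.
rewrite -cycle0123E (nth_map 0%N) ?size_iota // nth_iota //= add0n.
by rewrite [RHS]inordK.
Qed.

Let o k : 'I_6 := inord k.
Let o0 : ord0 = o 0. Proof. by apply/val_inj; rewrite /= inordK. Qed.

Let d j := x ord0 j.

Let to_d j : to (d j) (x j (o 1) / d (o 1)).
Proof.
have := to_s j ord0.
have -> : cycle0123 ord0 = o 1 by rewrite o0 cycle_inord.
by rewrite /s x00 divr1 x_sym.
Qed.

(** This expresses mu / d_j^2 through column j of s, on which sigma is known. *)
Let norm j : \sum_k s k j ^+ 2 = mu / d j ^+ 2.
Proof.
transitivity ((\sum_k x j k * x k j) / d j ^+ 2); last by rewrite xx eqxx mul1r.
rewrite mulr_suml; apply: eq_bigr => k _.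
by rewrite /s expr_div_n expr2 (x_sym j).
Qed.

Let to_norm j : to (mu / d j ^+ 2) (mu / d (cycle0123 j) ^+ 2).
Proof.
rewrite -!norm; apply: to_sum => k; rewrite !expr2.
exact: toM (to_s _ _) (to_s _ _).
Qed.

(* The signs in sigma(d_j) = +- d_(sigma j) / d_1. *)
Let e j := x j (o 1) / d (cycle0123 j).

(** Write mu as (mu / d_j^2) d_j^2 and apply sigma to the factors; comparison with sigma(mu) = mu /
    d_1^2 gives x_j1^2 = d_(sigma j)^2. *)
Let e_sqr j : e j ^+ 2 = 1.
Proof.
have := toM (to_norm j) (toM (to_d j) (to_d j)).
rewrite -expr2 divfK ?expf_neq0 ?x0_neq0 // => /to_fun H.
have := to_norm ord0; rewrite /d x00 expr1n divr1 => /H.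
have -> : cycle0123 ord0 = o 1 by rewrite o0 cycle_inord.
have d1N := x0_neq0 (o 1); have dcN := x0_neq0 (cycle0123 j).
have muN : mu / x ord0 (o 1) ^+ 2 != 0.
  by rewrite mulf_neq0 ?invr_neq0 ?expf_neq0.
move=> E; apply: (mulfI muN); rewrite mulr1 -[RHS]E /e /d; field.
by rewrite d1N dcN.
Qed.

Let x1E j : x j (o 1) = e j * d (cycle0123 j).
Proof. by rewrite divfK. Qed.

Let to_dE j : to (d j) (e j * d (cycle0123 j) / d (o 1)).
Proof. by rewrite -x1E. Qed.

(** Both sides are sigma(x_ij) d_1, computed from x_ij = s_ij d_j and from x_ji = s_ji d_i. *)
Let galois_sym i j : x i (cycle0123 j) * e j = x j (cycle0123 i) * e i.
Proof.
have to_x a b : to (x a b) (x a (cycle0123 b) * e b / d (o 1)).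
  have := toM (to_s a b) (to_d b); rewrite divfK ?x0_neq0 // x1E.
  congr to; rewrite /s /d; field.
  by rewrite !x0_neq0.
have d1N : (d (o 1))^-1 != 0 by rewrite invr_neq0 ?x0_neq0.
by apply: (mulIf d1N); apply: (to_fun (to_x i j)); rewrite x_sym; apply: to_x.
Qed.

Let e1 := e (o 1). Let e2 := e (o 2). Let e4 := e (o 4). Let e5 := e (o 5).
Let e1K : e1 * e1 = 1. Proof. by rewrite -expr2 e_sqr. Qed.
Let e2K : e2 * e2 = 1. Proof. by rewrite -expr2 e_sqr. Qed.
Let e4K : e4 * e4 = 1. Proof. by rewrite -expr2 e_sqr. Qed.
Let e5K : e5 * e5 = 1. Proof. by rewrite -expr2 e_sqr. Qed.

Let u := d (o 4). Let v := d (o 5).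
Let k := e4 * e5.
(** The signs are chosen so that sigma maps y_i to y_(i+1) / y_1 with no sign left over. *)
Let y1 := e4 * d (o 1). Let y2 := e1 * d (o 2).
Let y3 := e1 * e2 * e4 * d (o 3).
Let A := x (o 4) (o 4). Let B := x (o 4) (o 5). Let E := x (o 5) (o 5).

(* Up to the signs of its rows and columns, x is this matrix. *)
Let z := [:: [:: 1; y1; y2; y3; u; v];
             [:: y1; y2; y3; 1; u; k * v];
             [:: y2; y3; 1; y1; u; v];
             [:: y3; 1; y1; y2; u; k * v];
             [:: u; u; u; u; A; B];
             [:: v; k * v; v; k * v; B; E]].
Let sg := [:: 1; e4; e1; e1 * e2 * e4; 1; 1].

(** [x1E] gives column 1 from row 0, and [galois_sym], used as [step], propagates along the orbits
    to all entries outside the block of labels 4 and 5. *)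
Let xo i j : (i < 6)%N -> (j < 6)%N ->
  x (o i) (o j) = nth 0 sg i * nth 0 sg j * nth 0 (nth [::] z i) j.
Proof.
have c0 : cycle0123 (o 0) = o 1 by exact: cycle_inord.
have c1 : cycle0123 (o 1) = o 2 by exact: cycle_inord.
have c2 : cycle0123 (o 2) = o 3 by exact: cycle_inord.
have c3 : cycle0123 (o 3) = o 0 by exact: cycle_inord.
have c4 : cycle0123 (o 4) = o 4 by exact: cycle_inord.
have c5 : cycle0123 (o 5) = o 5 by exact: cycle_inord.
have x11 := x1E (o 1); have x21 := x1E (o 2); have x31 := x1E (o 3).
have x41 := x1E (o 4); have x51 := x1E (o 5).
rewrite c1 -/e1 in x11; rewrite c2 -/e2 in x21; rewrite c3 in x31.
rewrite c4 -/e4 in x41; rewrite c5 -/e5 in x51.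
have step a b : x a (cycle0123 b) = x b (cycle0123 a) * e a * e b.
  by rewrite -galois_sym -mulrA -expr2 e_sqr mulr1.
have x0 b : x (o 0) b = d b by rewrite -o0.
have d0 : d (o 0) = 1 by rewrite -o0.
have x42 : x (o 4) (o 2) = e1 * u.
  by have := step (o 4) (o 1); rewrite c1 c4 (x_sym (o 1)) x41 => ->;
    rewrite -/e1 -/e2 -/e4 -/e5 -/u -/v; ring: e4K.
have x52 : x (o 5) (o 2) = e1 * v.
  by have := step (o 5) (o 1); rewrite c1 c5 (x_sym (o 1)) x51 => ->;
    rewrite -/e1 -/e2 -/e4 -/e5 -/u -/v; ring: e5K.
have x43 : x (o 4) (o 3) = e1 * e2 * e4 * u.
  by have := step (o 4) (o 2); rewrite c2 c4 (x_sym (o 2)) x42 => ->;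
    rewrite -/e1 -/e2 -/e4 -/e5 -/u -/v; ring.
have x53 : x (o 5) (o 3) = e1 * e2 * e5 * v.
  by have := step (o 5) (o 2); rewrite c2 c5 (x_sym (o 2)) x52 => ->;
    rewrite -/e1 -/e2 -/e4 -/e5 -/u -/v; ring.
(* After a full turn of sigma, row 4 returns to u, which forces this sign. *)
have e3E : e (o 3) = e1 * e2.
  have := step (o 4) (o 3); rewrite c3 c4 x_sym x0 (x_sym (o 3)) x43 => E43.
  apply: (mulfI (x0_neq0 (o 4))); rewrite -/(d _) {1}E43 -/e4 -/u.
  by have e3K := e_sqr (o 3); rewrite expr2 in e3K; ring: e4K e3K.
rewrite e3E d0 mulr1 in x31.
have x22 : x (o 2) (o 2) = 1.
  have := step (o 2) (o 1); rewrite c1 c2 (x_sym (o 1)) x31 -/e1 -/e2 => ->.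
  by ring: e1K e2K.
have x32 : x (o 3) (o 2) = e2 * d (o 1).
  have := step (o 3) (o 1); rewrite c1 c3 (x_sym (o 1)) x0 e3E -/e1 => ->.
  by ring: e1K.
have x33 : x (o 3) (o 3) = e1 * d (o 2).
  have := step (o 3) (o 2); rewrite c2 c3 (x_sym (o 2)) x0 e3E -/e2 => ->.
  by ring: e2K.
have xs := (x0, d0, x11, x21, x31, x41, x51, x42, x52, x43, x53, x22, x32, x33).
have z_sym a b : (a < 6)%N -> (b < 6)%N -> (nth [::] z a)`_b = (nth [::] z
  b)`_a.
  by case: a => [|[|[|[|[|[|a]]]]]] //; case: b => [|[|[|[|[|[|b]]]]]].
have {}xs a b : (b <= a)%N -> (a < 6)%N ->
    x (o a) (o b) = sg`_a * sg`_b * (nth [::] z a)`_b.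
  case: a => [|[|[|[|[|[|a]]]]]]; case: b => [|[|[|[|[|[|b]]]]]] //= _ _;
  rewrite ?(x_sym _ (o 0)) ?xs /y1 /y2 /y3 /k ?(x_sym (o 5) (o 4));
  by rewrite -/u -/v -/A -/B -/E; ring: e1K e2K e4K e5K.
move=> i6 j6; case/orP: (leq_total j i) => ij; first exact: xs.
by rewrite x_sym xs // z_sym // [sg`_j * _]mulrC.
Qed.

Let sg_sqr i : (i < 6)%N -> sg`_i * sg`_i = 1.
Proof.
by case: i => [|[|[|[|[|[|i]]]]]] //= _; ring: e1K e2K e4K.
Qed.

(** x and z are conjugate by a diagonal matrix of signs, so the matrix identities pass to z. The sum
    over naturals unfolds by computation. *)
Let z_sumE (t : 'I_6 -> F) i j : (i < 6)%N -> (j < 6)%N ->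
  \sum_k x (o i) k * t k * x k (o j) = sg`_i * sg`_j *
    \sum_(0 <= k < 6) (nth [::] z i)`_k * t (o k) * (nth [::] z k)`_j.
Proof.
move=> i6 j6; rewrite big_mkord mulr_sumr; apply: eq_bigr => m _.
rewrite -[m in LHS]inord_val -/(o m) !xo // -/(o m).
transitivity (sg`_i * sg`_j * (sg`_m * sg`_m) *
    ((nth [::] z i)`_m * t (o m) * (nth [::] z m)`_j)); first by ring.
by rewrite sg_sqr // mulr1.
Qed.

Let t1 := th (o 1). Let t2 := th (o 2). Let t3 := th (o 3).
Let t4 := th (o 4). Let t5 := th (o 5).
Let t0 : th (o 0) = 1. Proof. by rewrite -o0. Qed.

Let sg_neq0 i j : (i < 6)%N -> (j < 6)%N -> sg`_i * sg`_j != 0.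
Proof.
have sgN a : (a < 6)%N -> sg`_a != 0.
  move=> a6; apply/eqP => sg0; have /eqP := sg_sqr a6.
  by rewrite sg0 mul0r eq_sym oner_eq0.
by move=> i6 j6; rewrite mulf_neq0 ?sgN.
Qed.

Let zz i j : (i < 6)%N -> (j < 6)%N ->
  \sum_(0 <= k < 6) (nth [::] z i)`_k * 1 * (nth [::] z k)`_j = (i == j)%:R *
    mu.
Proof.
move=> i6 j6; apply: (mulfI (sg_neq0 i6 j6)); rewrite -(z_sumE (fun=> 1)) //.
under eq_bigr do rewrite mulr1.
rewrite xx -val_eqE /= !inordK //; have [<-|_] := eqVneq i j;
  last by rewrite !mul0r mulr0.
by rewrite sg_sqr // !mul1r.
Qed.

Let zTz i j : (i < 6)%N -> (j < 6)%N -> th (o i) * th (o j) *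
  \sum_(0 <= k < 6) (nth [::] z i)`_k * th (o k) * (nth [::] z k)`_j
    = p * (nth [::] z i)`_j.
Proof.
move=> i6 j6; apply: (mulfI (sg_neq0 i6 j6)).
by rewrite mulrCA -z_sumE // xTx xo // mulrCA.
Qed.

Let zT'z i j : (i < 6)%N -> (j < 6)%N -> p *
  \sum_(0 <= k < 6) (nth [::] z i)`_k * (th (o k))^-1 * (nth [::] z k)`_j
    = mu * (th (o i) * th (o j) * (nth [::] z i)`_j).
Proof.
move=> i6 j6; apply: (mulfI (sg_neq0 i6 j6)).
rewrite mulrCA -(z_sumE (fun k => (th k)^-1)) // xT'x xo //; ring.
Qed.

Let u_neq0 : u != 0 := x0_neq0 _.
Let v_neq0 : v != 0 := x0_neq0 _.

(** The inverse of [y1], by [wy1]. *)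
Let w := e4 / d (o 1).

Let to_e j : to (e j) (e j).
Proof.
have /eqP := e_sqr j; rewrite -subr_eq0 subr_sqr_1 mulf_eq0 subr_eq0 addr_eq0.
by case/orP => /eqP ->; [|apply: toN].
Qed.

Let kK : k * k = 1.
Proof. by rewrite /k mulrACA e4K -expr2 e_sqr mulr1. Qed.

Let to_do i j : (i < 6)%N -> nth 0%N [:: 1; 2; 3; 0; 4; 5]%N i = j ->
  to (d (o i)) (e (o i) * d (o j) / d (o 1)).
Proof. by move=> i6 <-; have := to_dE (o i);
  rewrite [cycle0123 _]cycle_inord. Qed.

Let wy1 : w * y1 = 1.
Proof.
have d1N : d (o 1) != 0 := x0_neq0 _.
by rewrite /w /y1 -[RHS]e4K; field.
Qed.

Let to_y1 : to y1 (y2 * w).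
Proof.
have := toM (to_e (o 4)) (@to_do 1 2 isT erefl); rewrite -/e1 -/e4.
by congr to; rewrite /y2 /w; ring.
Qed.

Let to_y2 : to y2 (y3 * w).
Proof.
have := toM (to_e (o 1)) (@to_do 2 3 isT erefl); rewrite -/e1 -/e2.
by congr to; rewrite /y3 /w; ring: e4K.
Qed.

Let e3E : e (o 3) = e1 * e2.
Proof.
have := x1E (o 3); rewrite xo //= cycle_inord //= -/(o 0) -o0 /d x00 !mulr1 =>
  <-.
by ring: e4K.
Qed.

Let to_y3 : to y3 w.
Proof.
have := toM (toM (toM (to_e (o 1)) (to_e (o 2))) (to_e (o 4)))
   (@to_do 3 0 isT erefl).
rewrite e3E -o0 /d x00 mulr1 -/e1 -/e2 -/e4.
by congr to; rewrite /w /d; ring: e1K e2K.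
Qed.

Let to_u : to u (u * w).
Proof. by have := @to_do 4 4 isT erefl; congr to; rewrite /w /u -/e4; ring. Qed.

Let to_v : to v (k * v * w).
Proof.
have := @to_do 5 5 isT erefl; congr to; rewrite /w /v /k -/e5.
by ring: e4K.
Qed.

Let to_nat n : to n%:R n%:R.
Proof. by elim: n => [|n IHn]; rewrite ?mulrSr; [exact: to0|exact: toD]. Qed.

Let w_neq0 : w != 0.
Proof. by apply: contra_eq_neq wy1 => ->; rewrite mul0r eq_sym oner_neq0. Qed.

Let fixed_s i j : (i < 6)%N -> (3 < j < 6)%N -> to (s (o i) (o j)) (s (o i) (o
  j)).
Proof.
move=> i6 /andP[j3 j6]; have := to_s (o i) (o j);
  rewrite [cycle0123 _]cycle_inord //.
by case: j j3 j6 => [|[|[|[|[|[|j]]]]]].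
Qed.

Let equal_signs_absurd : k = 1 -> False.
Proof.
move=> k1.
have S00 := zz (isT : 0 < 6)%N (isT : 0 < 6)%N.
have S01 := zz (isT : 0 < 6)%N (isT : 1 < 6)%N.
have S02 := zz (isT : 0 < 6)%N (isT : 2 < 6)%N.
have S04 := zz (isT : 0 < 6)%N (isT : 4 < 6)%N.
have S05 := zz (isT : 0 < 6)%N (isT : 5 < 6)%N.
have S44 := zz (isT : 4 < 6)%N (isT : 4 < 6)%N.
have S45 := zz (isT : 4 < 6)%N (isT : 5 < 6)%N.
rewrite unlock /= k1 ?mul0r ?mul1r in S00 S01 S02 S04 S05 S44 S45.
pose Z := 1 - y1 + y2 - y3; pose q b c := (b ^+ 2 + c ^+ 2 + 4) * u.
(* The quotients are s_44, s_54, s_45 and s_55, all fixed by sigma; the next argument and [Z] are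
   the plain and the alternating sum of the y_i. *)
have [||||||||c0] := @equal_sign_case F u v (A / u) (B / u) (B / v) (E / v)
  (1 + y1 + y2 + y3) Z mu => //.
- by rewrite !divfK.
- by rewrite !divfK //; rewrite -[RHS]S45; ring.
- rewrite divfK //; apply: (mulfI u_neq0).
  by apply: (lincomb1 1 S04); field.
- rewrite divfK //; apply: (mulfI v_neq0).
  by apply: (lincomb1 1 S05); field.
- by apply: (lincomb3 1 1 (- 2) S00 S02 S01); rewrite /Z; ring.
- by apply: (lincomb1 (- 1) S44); field.
rewrite -/(q _ _); set b := B / u; set c := B / v.
have to_b : to b b by rewrite /b /B x_sym; exact: (@fixed_s 5 4).
have to_c : to c c by exact: (@fixed_s 4 5).
have to_Z : to Z (- (Z * w)).
  have := toD (toD (toD to1 (toN to_y1)) to_y2) (toN to_y3).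
  by congr to; rewrite /Z -[X in X - _ + _ - _]wy1; ring.
have to_q : to (q b c) (q b c * w).
  have := toM (toD (toD (toM to_b to_b) (toM to_c to_c)) (to_nat 4)) to_u.
  by rewrite -!expr2; congr to; rewrite /q; ring.
have to_cZ := toM (toM (to_nat 2) to_c) to_Z.
have Z0 : Z != 0.
  apply: contra_neq mu_neq0 => Z0.
  have <- : Z ^+ 2 = mu.
    by apply: (lincomb3 1 1 (- 2) S00 S02 S01); rewrite /Z; ring.
  by rewrite Z0 expr0n.
have two0 : 2 != 0 :> F by rewrite pnatr_eq0.
have cZN : 2 * c * Z * w * 2 != 0.
  exact: mulf_neq0 (mulf_neq0 (mulf_neq0 (mulf_neq0 two0 c0) Z0) w_neq0) two0.
(* Whichever sign relates 2 c Z to q, sigma reverses it, so that 2 c Z = 0. *)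
move=> /eqP; rewrite eqf_sqr => /orP[]/eqP cZq; case/eqP: cZN.
  have H : 2 * c * - (Z * w) = q b c * w by apply: to_fun to_cZ _; rewrite cZq.
  by apply: (lincomb2 w (- 1) cZq H); ring.
have H : 2 * c * - (Z * w) = - (q b c * w).
  by apply: to_fun to_cZ _; rewrite cZq; apply: toN.
by apply: (lincomb2 w (- 1) cZq H); ring.
Qed.

Let opposite_signs_absurd : k = - 1 -> False.
Proof.
move=> k1.
have S00 := zz (isT : 0 < 6)%N (isT : 0 < 6)%N.
have S02 := zz (isT : 0 < 6)%N (isT : 2 < 6)%N.
have S04 := zz (isT : 0 < 6)%N (isT : 4 < 6)%N.
have S14 := zz (isT : 1 < 6)%N (isT : 4 < 6)%N.
have S44 := zz (isT : 4 < 6)%N (isT : 4 < 6)%N.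
have S55 := zz (isT : 5 < 6)%N (isT : 5 < 6)%N.
have T45 := zTz (isT : 4 < 6)%N (isT : 5 < 6)%N.
have T45' := zT'z (isT : 4 < 6)%N (isT : 5 < 6)%N.
have T40 := zTz (isT : 4 < 6)%N (isT : 0 < 6)%N.
have T41 := zTz (isT : 4 < 6)%N (isT : 1 < 6)%N.
have T42 := zTz (isT : 4 < 6)%N (isT : 2 < 6)%N.
have T43 := zTz (isT : 4 < 6)%N (isT : 3 < 6)%N.
have T50 := zTz (isT : 5 < 6)%N (isT : 0 < 6)%N.
have T52 := zTz (isT : 5 < 6)%N (isT : 2 < 6)%N.
have T02 := zTz (isT : 0 < 6)%N (isT : 2 < 6)%N.
have T11 := zTz (isT : 1 < 6)%N (isT : 1 < 6)%N.
rewrite unlock /= k1 ?mul0r ?mul1r in S00 S02 S04 S14 S44 S55.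
rewrite unlock /= k1 t0 in T45 T45' T40 T41 T42 T43 T50 T52 T02 T11.
rewrite -/t1 -/t2 -/t3 -/t4 -/t5 in T45 T45' T40 T41 T42 T43 T50 T52 T02 T11.
rewrite invr1 in T45'.
have two0 : 2 != 0 :> F by rewrite pnatr_eq0.
(* Rows 0 and 1 end in v and -v, so their products with column 4 differ by 2 v B. *)
have B0 : B = 0.
  apply: (mulfI (mulf_neq0 two0 v_neq0)).
  by apply: (lincomb2 1 (- 1) S04 S14); ring.
rewrite B0 in S44 S55 T45 T45' T40 T41 T42 T43 T50 T52.
have t45N : t4 * t5 != 0 := mulf_neq0 (th_neq0 _) (th_neq0 _).
have uvN := mulf_neq0 u_neq0 v_neq0.
have [] := @opposite_sign_case F u v y1 y2 y3 A E mu p t1 t2 t3 t4 t5 => //;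
  try exact: th_neq0.
- by apply: (lincomb1 1 S00); ring.
- by apply: (lincomb1 1 S02); ring.
- by apply: (lincomb1 1 S44); ring.
- by apply: (lincomb1 1 S55); ring.
- apply: (mulfI uvN); apply: (mulfI t45N).
  by apply: (lincomb1 1 T45); ring.
- by apply: (mulfI uvN); apply: (mulfI p_neq0); apply: (lincomb1 1 T45'); ring.
- by apply: (mulfI u_neq0); apply: (lincomb1 1 T40); ring.
- by apply: (mulfI u_neq0); apply: (lincomb1 1 T41); ring.
- by apply: (mulfI u_neq0); apply: (lincomb1 1 T42); ring.
- by apply: (mulfI u_neq0); apply: (lincomb1 1 T43); ring.
- by apply: (mulfI v_neq0); apply: (lincomb1 1 T50); ring.
- by apply: (mulfI v_neq0); apply: (lincomb1 1 T52); ring.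
- by apply: (lincomb1 1 T02); ring.
- by apply: (lincomb1 1 T11); ring.
- move=> uv; have uN := mulf_neq0 two0 (mulf_neq0 u_neq0 w_neq0).
  have tv : to v (- (v * w)) by have := to_v; rewrite k1; congr to; ring.
  case/eqP: uN; move/eqP: uv; rewrite eqf_sqr => /orP[]/eqP uv.
    have := to_u; rewrite {1}uv => /to_fun/(_ tv) H.
    by apply: (lincomb2 1 w H uv); ring.
  have := to_u; rewrite {1}uv => /to_fun/(_ (toN tv)) H.
  by apply: (lincomb2 1 w H uv); ring.
(* sigma fixes y2 = 1 and maps it to y3 w, where w is the inverse of y1. *)
move=> y2E; have := to_y2; rewrite {1}y2E => /to_fun/(_ to1) y3w.
have y13 : y3 = y1.
  by apply: (mulIf w_neq0); rewrite y3w [RHS]mulrC wy1.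
(* With y2 = 1 and y3 = y1, [S00] and [S02] have equal left-hand sides, and right-hand sides mu and
   0. *)
case/eqP: mu_neq0; apply: (lincomb2 (- 1) 1 S00 S02).
by rewrite y13 y2E; ring.
Qed.

Lemma four_cycle_absurd : False.
Proof.
have /eqP := kK; rewrite -expr2 -subr_eq0 subr_sqr_1 mulf_eq0 subr_eq0 addr_eq0.
by case/orP => /eqP; [exact: equal_signs_absurd | exact: opposite_signs_absurd].
Qed.
End FourCycle.

(** * The field Q(S) and the conclusion *)

Lemma in_QS_divring (R : realType) (C : modularCategory R) n
    (V : 'I_n.+1 -> C) : GRing.divring_closed [pred x | `[< in_QS V x >]].
Proof.
split=> [|x y /asboolP xK /asboolP yK|x y /asboolP xK /asboolP yK];
  apply/asboolP => K K_divring SK; have [K1 KB Kdiv] := K_divring.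
- exact: K1.
- by apply: KB; [exact: xK | exact: yK].
- by apply: Kdiv; [exact: xK | exact: yK].
Qed.

Theorem theorem29 (R : realType) :
  ~ exists (C : modularCategory R) (V : 'I_6 -> C),
      [/\ labelling V, self_dual V, ~ integral V
        & galois_image V = <[cycle0123]>%g].
Proof.
case=> C [V [V_lab V_sd _ V_gal]].
(* The generator of G is realized by an automorphism [phi] of Q(S). *)
have := cycle_id cycle0123; rewrite -V_gal inE => /asboolP[phi].
move=> [_ _ phi1 phiD phiM] phi_s.
have [s [d [th [s_mul SE balance th_neq0]]]] := modular_data V_lab V_sd.
have S_unit : Smatrix V \in unitmx.
  by apply: modular_nondegenerate; case: V_lab.
have [x [mu [p [[x_sym x00 x0_neq0 sE [mu0 p0 xx xTx xT'x]] th0]]]] :=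
  modular_relations (@fusion_multC _ _ _ V) (fusion_multCA V_lab V_sd)
    (fusion_mult0 V_lab) s_mul SE balance th_neq0 S_unit.
(* Rescaling S to x leaves the eigenvalue matrix unchanged, so [phi] permutes the columns formed
   from x. *)
have eigE i j : eigenvalue_matrix V i j = x i j / x ord0 j by rewrite mxE sE.
have QS_divring := in_QS_divring V.
apply: (four_cycle_absurd x_sym x00 x0_neq0 mu0 p0 th_neq0 th0 xx xTx xT'x
  (phi := phi) QS_divring) => [i j||a b|a b|i j] //.
- rewrite -eigE mxE; have [_ _ QS_div] := QS_divring.
  by apply: QS_div; apply/asboolP => K _ SK; apply: SK.
- by move=> /asboolP aK /asboolP bK; apply: phiD.
- by move=> /asboolP aK /asboolP bK; apply: phiM.
- by rewrite -!eigE phi_s.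
Qed.
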